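(* Let $X$, $A$, $B$, $C$, $\varepsilon$ be as in the context, and assume in addition that $A=A_0+\varepsilon$ where $A_0$ is a densely defined linear positive self-adjoint operator in $X$, and that $C=-\varepsilon$ (restricted to $D(A^{1/2})$). Let $T_\pm$ be the semigroups generated by $G_\pm$. Then $|T_\pm(t)|\leqslant e\,\varepsilon^{1/2}\,t\,\exp(\mu_Bt)$ for all $t\geqslant\varepsilon^{-1/2}$, where $\mu_B:=0$ if $B$ is symmetric and $\mu_B:=\|B\|$ if $B$ is bounded.
   Context: $(X,\langle\cdot|\cdot\rangle)$ is a nontrivial complex Hilbert space with norm $\|\cdot\|$. $A:D(A)\to X$ is a densely defined self-adjoint linear operator with $\langle\xi|A\xi\rangle\geqslant\varepsilon\langle\xi|\xi\rangle$ for all $\xi\in D(A)$ for some $\varepsilon>0$; $A^{1/2}$ is its positive self-adjoint square root. $B:D(A^{1/2})\to X$ is linear with $\|B\xi\|^2\leqslant a^2\|A^{1/2}\xi\|^2+b^2\|\xi\|^2$ for all $\xi\in D(A^{1/2})$, for some $a\in[0,1)$, $b\in\mathbb{R}$, and $B$ is symmetric or bounded. $Y:=D(A^{1/2})\times X$ with inner product $(\xi|\eta):=\langle A^{1/2}\xi_1|A^{1/2}\eta_1\rangle+\langle\xi_2|\eta_2\rangle$ and norm $|\cdot|$ (also for operator norms on $Y$). $H:D(A)\times D(A^{1/2})\to Y$, $H\xi:=(-i\xi_2,iA\xi_1)$; $\hat B:D(H)\to Y$, $\hat B\xi:=(0,-B\xi_2)$; $V:Y\to Y$, $V\xi:=(0,iC\xi_1)$;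 $G_+:=-i(H+\hat B+V)$, $G_-:=i(H+\hat B+V)$. $T_\pm$ is the strongly continuous semigroup with $T_\pm(t)=e^{-tG_\pm}$, $t\geqslant0$ (i.e. $\frac{d}{dt}T_\pm(t)\xi=-G_\pm T_\pm(t)\xi$ for $\xi\in D(H)$). *)

(* Defs.v *)
(* MathComp + MathComp-Analysis, complex numbers from mathcomp-real-closed. *)
From HB Require Import structures.
From mathcomp Require Import all_boot all_order all_algebra.
From mathcomp Require Import complex.
From mathcomp Require Import all_classical all_reals all_analysis.

Set Implicit Arguments.
Unset Strict Implicit.
Unset Printing Implicit Defensive.

Import Order.TTheory GRing.Theory Num.Theory.
Local Open Scope ring_scope.
Local Open Scope classical_set_scope.
Local Open Scope complex_scope.

Section HilbertDefs.
Variables (R : realType) (V : lmodType R[i]) (ip : V -> V -> R[i]).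

(** norm induced by the inner product <x|y> (linear in the 2nd argument) *)
Definition hnorm (x : V) : R := Num.sqrt (complex.Re (ip x x)).

Definition is_inner_product : Prop :=
  (forall (a : R[i]) (x y z : V), ip x (a *: y + z) = a * ip x y + ip x z) /\
  (forall x y : V, ip y x = (ip x y)^*) /\
  (forall x : V, 0 <= complex.Re (ip x x)) /\
  (forall x : V, ip x x = 0 -> x = 0).

Definition hcomplete : Prop :=
  forall u : nat -> V,
    (forall e : R, 0 < e -> exists N : nat, forall m n : nat,
        (N <= m)%N -> (N <= n)%N -> hnorm (u m - u n) < e) ->
    exists l : V, forall e : R, 0 < e -> exists N : nat, forall n : nat,
        (N <= n)%N -> hnorm (u n - l) < e.

(** nontrivial complex Hilbert space *)
Definition is_hilbert : Prop :=
  is_inner_product /\ hcomplete /\ exists x : V, x <> 0.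

Definition subspace (D : set V) : Prop :=
  D 0 /\ forall (a : R[i]) (x y : V), D x -> D y -> D (a *: x + y).

Definition dense (D : set V) : Prop :=
  forall (x : V) (e : R), 0 < e -> exists y, D y /\ hnorm (x - y) < e.

Definition linear_on (D : set V) (A : V -> V) : Prop :=
  forall (a : R[i]) (x y : V), D x -> D y -> A (a *: x + y) = a *: A x + A y.

(** densely defined linear operator with domain D (values outside D irrelevant) *)
Definition densely_defined (D : set V) (A : V -> V) : Prop :=
  subspace D /\ dense D /\ linear_on D A.

(** A = A^* : y is in D(A^* ) with A^* y = z  iff  y in D and A y = z *)
Definition self_adjoint (D : set V) (A : V -> V) : Prop :=
  densely_defined D A /\
  forall y z : V, (forall x, D x -> ip (A x) y = ip x z) <-> (D y /\ A y = z).

Definition positive_op (D : set V) (A : V -> V) : Prop :=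
  forall x, D x -> 0 <= ip x (A x).

(** (DS, S) is the positive self-adjoint square root of (D, A) *)
Definition is_pos_sqrt (D : set V) (A : V -> V) (DS : set V) (S : V -> V) : Prop :=
  self_adjoint DS S /\ positive_op DS S /\
  (forall x, D x <-> (DS x /\ DS (S x))) /\
  (forall x, D x -> S (S x) = A x).

Definition symmetric_on (D : set V) (B : V -> V) : Prop :=
  forall x y, D x -> D y -> ip (B x) y = ip x (B y).

Definition bounded_on (D : set V) (B : V -> V) : Prop :=
  exists c : R, forall x, D x -> hnorm (B x) <= c * hnorm x.

(** operator norm of B (on its dense domain D) *)
Definition opnorm_on (D : set V) (B : V -> V) : R :=
  sup [set r | exists x, D x /\ hnorm x <= 1 /\ r = hnorm (B x)].

(** The space Y = D(A^{1/2}) x X, with norm |xi|^2 = ||A^{1/2} xi1||^2 + ||xi2||^2 *)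
Definition inY (DS : set V) (xi : V * V) : Prop := DS xi.1.

Definition normY (S : V -> V) (xi : V * V) : R :=
  Num.sqrt (hnorm (S xi.1) ^+ 2 + hnorm xi.2 ^+ 2).

Definition addY (xi eta : V * V) : V * V := (xi.1 + eta.1, xi.2 + eta.2).
Definition oppY (xi : V * V) : V * V := (- xi.1, - xi.2).
Definition scaleY (c : R[i]) (xi : V * V) : V * V := (c *: xi.1, c *: xi.2).

(** D(H) = D(A) x D(A^{1/2}) *)
Definition domH (D DS : set V) (xi : V * V) : Prop := D xi.1 /\ DS xi.2.

Definition Hop (A : V -> V) (xi : V * V) : V * V := (- ('i *: xi.2), 'i *: A xi.1).
Definition Bhat (B : V -> V) (xi : V * V) : V * V := (0, - B xi.2).
Definition Vop (C : V -> V) (xi : V * V) : V * V := (0, 'i *: C xi.1).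

(** G_+ = -i(H + Bhat + V) (pm = true),  G_- = i(H + Bhat + V) (pm = false) *)
Definition Gop (pm : bool) (A B C : V -> V) (xi : V * V) : V * V :=
  scaleY (if pm then - 'i else 'i) (addY (addY (Hop A xi) (Bhat B xi)) (Vop C xi)).

(** T is a strongly continuous semigroup of bounded operators on Y whose
    generator is -G (with domain DG), i.e. T(t) = exp(-t G). *)
Definition C0_semigroup_gen (DS : set V) (S : V -> V) (DG : V * V -> Prop)
  (G : V * V -> V * V) (T : R -> V * V -> V * V) : Prop :=
  (forall t xi, 0 <= t -> inY DS xi -> inY DS (T t xi)) /\
  (forall t (c : R[i]) xi eta, 0 <= t -> inY DS xi -> inY DS eta ->
      T t (addY (scaleY c xi) eta) = addY (scaleY c (T t xi)) (T t eta)) /\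
  (forall t, 0 <= t -> exists M : R, forall xi, inY DS xi ->
      normY S (T t xi) <= M * normY S xi) /\
  (forall xi, inY DS xi -> T 0 xi = xi) /\
  (forall t s xi, 0 <= t -> 0 <= s -> inY DS xi -> T (t + s) xi = T t (T s xi)) /\
  (forall xi, inY DS xi -> forall e : R, 0 < e -> exists2 d : R, 0 < d &
      forall h, 0 < h < d -> normY S (addY (T h xi) (oppY xi)) < e) /\
  (forall xi eta, inY DS xi -> inY DS eta ->
      ((forall e : R, 0 < e -> exists2 d : R, 0 < d & forall h, 0 < h < d ->
          normY S (addY (scaleY (h^-1)%:C (addY (T h xi) (oppY xi))) (oppY eta)) < e)
       <-> (DG xi /\ eta = oppY (G xi)))).

(** operator norm |T(t)| on Y *)
Definition opnormY (DS : set V) (S : V -> V) (T : R -> V * V -> V * V) (t : R) : R :=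
  sup [set r | exists xi, inY DS xi /\ normY S xi <= 1 /\ r = normY S (T t xi)].

End HilbertDefs.

(* Main.v *)
Require Import Defs.
From HB Require Import structures.
From mathcomp Require Import all_boot all_order all_algebra.
From mathcomp Require Import complex ring lra.
From mathcomp Require Import all_classical all_reals all_analysis.
Import Order.TTheory GRing.Theory Num.Theory.
Local Open Scope ring_scope.
Local Open Scope classical_set_scope.
Local Open Scope complex_scope.

(** Along an orbit u = (u1, u2) of the semigroup one has u1' = u2 and
    u2' = - A0 u1 - i B u2 (up to a common sign), so the energy
    E = <u1|A0 u1> + |u2|^2 satisfies E' = 2 Im <u2|B u2> up to sign, hence
    E(t) <= exp(2 mu t) E(0).  Then |u1(t)| <= |u1(0)| + t exp(mu t) E(0)^(1/2),
    and |u|^2 = E + eps |u1|^2 gives, with tau = eps^(1/2) t >= 1,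
    |u(t)|^2 <= 4 tau^2 exp(2 mu t) |u(0)|^2, and 4 <= e^2.

    Only right derivatives of orbits are available from the definition of the
    generator; they suffice once orbits are left continuous, which follows from
    local boundedness of the semigroup, i.e. from uniform boundedness on the
    complete space Y.  Completeness of Y and density of D(H) in Y both come from
    the surjectivity of S = A^(1/2). *)

Set Implicit Arguments.
Unset Strict Implicit.

(** The factor t is the price of a possible kernel of A0: for v in that kernel the energy of (v, 0)
    vanishes, so the energy controls |u2| but not |u1|, and |u1| has to be recovered by integrating
    u2 over [0, t]. For the same reason the forms below are only semi-inner products. Coercivity is
    given on D(A), whereas positivity of the energy needs eps |x|^2 <= |S x|^2 on all of D(S).
    Instead of spectral calculus, the equation A y = S x is solved; its solvability comes from
    minimising |A y - f|, and the surjectivity of S follows from it too. A norm need not be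
    differentiable along an orbit where it vanishes, so the differential inequalities are applied to
    the squared energy and to linear functionals of the orbit. They require initial data in D(H);
    the boundedness of each single T(t) then extends the final estimate to Y. *)

Section SemiInnerProduct.
Variables (R : realType) (W : lmodType R[i]).

(** One notion for three forms: the real part of the inner product, its analogue on Y, and the
    energy. The scalars are real, definiteness is not asked for because the energy may degenerate,
    and [P] is there because S is linear only on its domain. *)
Definition semi_inner (P : set W) (q : W -> W -> R) : Prop :=
  [/\ Defs.subspace P,
      forall x y z, P x -> P y -> P z -> q (x + y) z = q x z + q y z,
      forall (r : R) x y, P x -> P y -> q (r%:C *: x) y = r * q x y,
      forall x y, P x -> P y -> q x y = q y x
    & forall x, P x -> 0 <= q x x].

Definition seminorm_of (q : W -> W -> R) (x : W) : R := Num.sqrt (q x x).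

Definition seminorm_complete (P : set W) (N : W -> R) : Prop :=
  forall u : nat -> W, (forall n, P (u n)) ->
    (forall e : R, 0 < e -> exists K : nat, forall m n : nat,
        (K <= m)%N -> (K <= n)%N -> N (u m - u n) < e) ->
    exists2 l : W, P l & forall e : R, 0 < e -> exists K : nat, forall n : nat,
        (K <= n)%N -> N (u n - l) < e.

Lemma subspace0 (P : set W) : Defs.subspace P -> P 0.
Proof. by case. Qed.

Lemma subspaceD (P : set W) x y : Defs.subspace P -> P x -> P y -> P (x + y).
Proof. by move=> [_ h] Px Py; rewrite -[x]scale1r; apply: h. Qed.

Lemma subspaceZ (P : set W) c x : Defs.subspace P -> P x -> P (c *: x).
Proof. by move=> [P0 h] Px; rewrite -[c *: x]addr0; apply: h. Qed.

Lemma subspaceN (P : set W) x : Defs.subspace P -> P x -> P (- x).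
Proof. by move=> sP Px; rewrite -scaleN1r; apply: subspaceZ. Qed.

Lemma subspaceB (P : set W) x y : Defs.subspace P -> P x -> P y -> P (x - y).
Proof. by move=> sP Px Py; apply: subspaceD => //; apply: subspaceN. Qed.

Variables (P : set W) (q : W -> W -> R).
Hypothesis hq : semi_inner P q.
Let N := seminorm_of q.

Let sP : Defs.subspace P. Proof. by case: hq. Qed.
Let PD x y : P x -> P y -> P (x + y). Proof. exact: subspaceD. Qed.
Let PZ c x : P x -> P (c *: x). Proof. exact: subspaceZ. Qed.
Let PN x : P x -> P (- x). Proof. exact: subspaceN. Qed.

Lemma semi_innerDl x y z : P x -> P y -> P z -> q (x + y) z = q x z + q y z.
Proof. by case: hq => _ h _ _ _; apply: h. Qed.

Lemma semi_innerC x y : P x -> P y -> q x y = q y x.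
Proof. by case: hq => _ _ _ h _; apply: h. Qed.

Lemma semi_innerZl r x y : P x -> P y -> q (r%:C *: x) y = r * q x y.
Proof. by case: hq => _ _ h _ _; apply: h. Qed.

Lemma semi_innerDr x y z : P x -> P y -> P z -> q x (y + z) = q x y + q x z.
Proof.
move=> Px Py Pz; rewrite semi_innerC ?semi_innerDl//; last exact: PD.
by rewrite (@semi_innerC y) // (@semi_innerC z).
Qed.

Lemma semi_innerZr r x y : P x -> P y -> q x (r%:C *: y) = r * q x y.
Proof.
by move=> Px Py; rewrite semi_innerC ?semi_innerZl ?(@semi_innerC y)//; apply: PZ.
Qed.

Lemma semi_innerNr x y : P x -> P y -> q x (- y) = - q x y.
Proof.
move=> Px Py; have := semi_innerZr (-1) Px Py.
by rewrite mulN1r => <-; rewrite rmorphN rmorph1 scaleN1r.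
Qed.

Lemma seminorm_ge0 x : 0 <= N x.
Proof. exact: sqrtr_ge0. Qed.

Lemma seminorm_sqr x : P x -> N x ^+ 2 = q x x.
Proof. by case: hq => _ _ _ _ h Px; rewrite sqr_sqrtr// h. Qed.

Lemma seminormZ r x : P x -> N (r%:C *: x) = `|r| * N x.
Proof.
move=> Px; rewrite /N /seminorm_of semi_innerZl ?semi_innerZr //; last exact: PZ.
by rewrite mulrA -expr2 sqrtrM ?sqr_ge0// sqrtr_sqr.
Qed.

Lemma seminorm0 : N 0 = 0.
Proof.
have := @seminormZ 0 0 (subspace0 sP).
by rewrite scaler0 normr0 mul0r.
Qed.

Lemma seminormN x : P x -> N (- x) = N x.
Proof.
move=> Px; have := @seminormZ (-1) x Px.
by rewrite normrN1 mul1r => <-; rewrite rmorphN rmorph1 scaleN1r.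
Qed.

Lemma seminormBC x y : P x -> P y -> N (x - y) = N (y - x).
Proof. by move=> Px Py; rewrite -opprB seminormN//; apply: PD => //; apply: PN. Qed.

Lemma seminorm_sqrD x y : P x -> P y ->
  N (x + y) ^+ 2 = N x ^+ 2 + 2 * q x y + N y ^+ 2.
Proof.
move=> Px Py; have Pxy := PD Px Py; rewrite !seminorm_sqr//.
rewrite semi_innerDl// !semi_innerDr// (@semi_innerC y)//; ring.
Qed.

Lemma seminorm_sqrDZ r x y : P x -> P y ->
  N (x + r%:C *: y) ^+ 2 = N x ^+ 2 + 2 * r * q x y + r ^+ 2 * N y ^+ 2.
Proof.
move=> Px Py; rewrite seminorm_sqrD ?semi_innerZr//; last exact: PZ.
by rewrite seminormZ// exprMn real_normK ?num_real//; ring.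
Qed.

(** The discriminant argument, except that [q] may be degenerate: null vectors on either side need
    their own test value of [r]. *)
Lemma semi_inner_CS x y : P x -> P y -> q x y <= N x * N y.
Proof.
move=> Px Py.
have pos r : 0 <= N x ^+ 2 + 2 * r * q x y + r ^+ 2 * N y ^+ 2.
  by rewrite -seminorm_sqrDZ// sqr_ge0.
have [Nx0 Ny0] := (seminorm_ge0 x, seminorm_ge0 y).
have [y0|yn0] := eqVneq (N y) 0.
  have [//|q0] := leP (q x y) (N x * N y).
  rewrite y0 mulr0 in q0.
  (* For [N y = 0] the polynomial is affine in [r]; with positive slope it would take the value -(N
     x)^2 - 2 here. *)
  have := pos (- (N x ^+ 2 + 1) / q x y).
  have -> : 2 * (- (N x ^+ 2 + 1) / q x y) * q x y = - (2 * (N x ^+ 2 + 1)).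
    by field; rewrite gt_eqF.
  by rewrite y0; nra.
have Nyp : 0 < N y by rewrite lt0r yn0.
have := pos (- (N x) / N y).
have -> : N x ^+ 2 + 2 * (- N x / N y) * q x y + (- N x / N y) ^+ 2 * N y ^+ 2
  = 2 * (N x / N y) * (N x * N y - q x y) by field.
(* If [N x = 0], the choice of [r] just made is 0 and gives no information; the minimiser
   [- q x y / N y ^+ 2] is used instead. *)
have [x0 _|xn0] := eqVneq (N x) 0.
  have [//|q0] := leP (q x y) (N x * N y).
  rewrite x0 mul0r in q0.
  have := pos (- (q x y) / N y ^+ 2).
  have -> : N x ^+ 2 + 2 * (- q x y / N y ^+ 2) * q x y
    + (- q x y / N y ^+ 2) ^+ 2 * N y ^+ 2 = - ((q x y / N y) ^+ 2).
    by rewrite x0; field.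
  by rewrite oppr_ge0 leNgt exprn_gt0// divr_gt0.
have Nxp : 0 < N x by rewrite lt0r xn0.
by rewrite pmulr_rge0 ?subr_ge0// mulr_gt0// divr_gt0.
Qed.

Lemma ler_seminormD x y : P x -> P y -> N (x + y) <= N x + N y.
Proof.
move=> Px Py; rewrite -ler_sqr ?nnegrE ?addr_ge0 ?seminorm_ge0//.
rewrite seminorm_sqrD//; have := semi_inner_CS Px Py; nra.
Qed.

Lemma ler_seminormB_dist x y z : P x -> P y -> P z ->
  N (x - z) <= N (x - y) + N (y - z).
Proof.
move=> Px Py Pz.
have -> : x - z = (x - y) + (y - z) by rewrite addrA subrK.
by apply: ler_seminormD; apply: PD => //; apply: PN.
Qed.

Lemma ler_seminorm_dist x y : P x -> P y -> N x <= N y + N (x - y).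
Proof.
move=> Px Py; rewrite -{1}[x](subrK y) addrC.
by apply: ler_seminormD => //; apply: PD => //; apply: PN.
Qed.

Lemma seminorm_parallelogram x y : P x -> P y ->
  N (x + y) ^+ 2 + N (x - y) ^+ 2 = 2 * N x ^+ 2 + 2 * N y ^+ 2.
Proof.
move=> Px Py; rewrite !seminorm_sqrD ?seminormN ?semi_innerNr//; last exact: PN.
ring.
Qed.

End SemiInnerProduct.

(* [F] plays the role of [x |-> |T x|]; the a priori bound makes the case
   [N x = 0] harmless. *)
Lemma le_sup_unit_ball (R : realType) (W : lmodType R[i]) (P : set W)
    (N F : W -> R) (M : R) :
  Defs.subspace P -> N 0 = 0 ->
  (forall x, P x -> 0 <= N x) ->
  (forall (r : R) x, P x -> N (r%:C *: x) = `|r| * N x) ->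
  (forall (r : R) x, P x -> F (r%:C *: x) = `|r| * F x) ->
  (forall x, P x -> F x <= M * N x) ->
  let E := [set r | exists x, P x /\ N x <= 1 /\ r = F x] in
  has_sup E /\ forall x, P x -> F x <= sup E * N x.
Proof.
move=> sP N0 Nge0 NZ FZ FM E.
have hE : has_sup E.
  split; first by exists (F 0), 0; split; [exact: subspace0|split; rewrite ?N0].
  exists `|M| => r [x [Px [Nx ->]]]; apply: (le_trans (FM _ Px)).
  have := ler_norm M; have := normr_ge0 M; have := Nge0 _ Px; nra.
split=> // x Px.
have [x0|xn0] := eqVneq (N x) 0.
  by apply: (le_trans (FM _ Px)); rewrite x0 !mulr0.
have Np : 0 < N x by rewrite lt0r xn0 Nge0.
have ninv : `|(N x)^-1| = (N x)^-1 by rewrite ger0_norm// invr_ge0 ltW.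
have : F ((N x)^-1%:C *: x) <= sup E.
  apply: (sup_upper_bound hE); exists ((N x)^-1%:C *: x).
  split; first exact: subspaceZ.
  by split=> //; rewrite NZ// ninv mulVf.
by rewrite FZ// ninv mulrC ler_pdivrMr.
Qed.

(** * Uniform boundedness on a complete seminormed subspace *)

Section UniformBoundedness.
Variables (R : realType) (W : lmodType R[i]) (P : set W) (q : W -> W -> R).
Hypothesis hq : semi_inner P q.
Let N := seminorm_of q.
Hypothesis Pcomplete : seminorm_complete P N.
Variable U : nat -> W -> W.
Hypothesis UP : forall n x, P x -> P (U n x).
Hypothesis UL : forall n (c : R[i]) x y, P x -> P y ->
  U n (c *: x + y) = c *: U n x + U n y.
Hypothesis UB : forall n, exists M : R, forall x, P x -> N (U n x) <= M * N x.

Let sP : Defs.subspace P. Proof. by case: hq. Qed.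

Let U0 n : U n 0 = 0.
Proof.
have P0 := subspace0 sP.
have := UL n (-1) P0 P0; rewrite scaler0 addr0 scaleN1r => {1}->.
by rewrite addNr.
Qed.

Let UZ n c x : P x -> U n (c *: x) = c *: U n x.
Proof.
by move=> Px; rewrite -[c *: x]addr0 UL ?U0 ?addr0//; exact: subspace0.
Qed.

Let UD n x y : P x -> P y -> U n (x + y) = U n x + U n y.
Proof. by move=> Px Py; rewrite -[in LHS](scale1r x) UL// scale1r. Qed.

Let UN n x : P x -> U n (- x) = - U n x.
Proof. by move=> Px; rewrite -scaleN1r UZ// scaleN1r. Qed.

(* Sokal's gliding hump: the n-th step has size at most 3^-n, and its sign is
   chosen so that |U_n x_(n+1)| is at least (2/3) 3^-n |U_n|; the later steps
   add up to at most (1/2) 3^-n and cannot undo this. *)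
Lemma uniform_boundedness :
  (forall n, exists2 x, P x & 6 * 3 ^+ n * n%:R * N x < N (U n x)) ->
  exists2 x, P x & forall n, n%:R <= N (U n x).
Proof.
move=> hU.
have N_ge0 x : 0 <= N x by exact: seminorm_ge0.
have p3 n : (0 : R) < 3 ^- n by rewrite invr_gt0 exprn_gt0.
have step n : exists Lx : R * W, [/\ P Lx.2, N Lx.2 <= 1,
    2 / 3 * Lx.1 <= N (U n Lx.2), 6 * 3 ^+ n * n%:R <= Lx.1
    & forall x, P x -> N (U n x) <= Lx.1 * N x].
  have [M hM] := UB n.
  have FZ (r : R) x : P x -> N (U n (r%:C *: x)) = `|r| * N (U n x).
    by move=> Px; rewrite UZ//; apply: (seminormZ hq); apply: UP.
  have [hE leE] := le_sup_unit_ball sP (seminorm0 hq) (fun x _ => N_ge0 x)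
    (seminormZ hq) FZ hM.
  set L := sup _ in leE *.
  have [x Px hx] := hU n.
  have lM : 6 * 3 ^+ n * n%:R < L.
    rewrite ltNge; apply/negP => c.
    have := lt_le_trans hx (leE _ Px).
    by rewrite ltNge ler_wpM2r.
  have L0 : 0 < L by apply: le_lt_trans lM; rewrite !mulr_ge0// exprn_ge0.
  (* A margin of L / 3 below the supremum yields the factor 2/3. *)
  have [r [y [Py [y1 ->]]] ry] := sup_adherent (divr_gt0 L0 (ltr0n _ 3)) hE.
  exists (L, y); split=> //=; last exact: ltW.
  apply/ltW/(le_lt_trans _ ry); rewrite -/L; lra.
have {hU}[f hf] := choice step.
pose y n := (3 ^- n)%:C *: (f n).2.
pose x := fix x n : W := match n with
  | 0%N => 0
  | k.+1 => if N (U k (y k)) <= N (U k (x k + y k)) then x k + y k else x k - y k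
  end.
have Pf n : P (f n).2 by case: (hf n).
have Py n : P (y n) by apply: subspaceZ.
have Px n : P (x n).
  elim: n => [|n IH] /=; first exact: subspace0.
  by case: ifP => _; [apply: subspaceD|apply: subspaceB].
have Ny n : N (y n) <= 3 ^- n.
  rewrite /N (seminormZ hq)// gtr0_norm//.
  by case: (hf n) => _ h _ _ _; rewrite ler_piMr// ltW.
have dx n : N (x n.+1 - x n) <= 3 ^- n.
  rewrite /=; case: ifP => _; first by rewrite [x n + y n]addrC addrK.
  by rewrite [x n - y n]addrC addrK /N (seminormN hq).
have Ux n : 2 / 3 * (f n).1 * 3 ^- n <= N (U n (x n.+1)).
  have low : 2 / 3 * (f n).1 * 3 ^- n <= N (U n (y n)).
    have Uy : N (U n (y n)) = 3 ^- n * N (U n (f n).2).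
      rewrite /y UZ//.
      rewrite /N (seminormZ hq) ?gtr0_norm//; exact: UP.
    by rewrite Uy mulrC ler_pM2l//; case: (hf n).
  apply: (le_trans low) => /=; case: ifP => // /negbT; rewrite -ltNge => lt.
  have Uxn := UP n (Px n); have Uyn := UP n (Py n).
  rewrite UD// in lt.
  rewrite UD ?UN//; last exact: subspaceN.
  have Q1 : P (U n (x n) - U n (y n)) by exact: subspaceB.
  have Q2 : P (U n (x n) + U n (y n)) by exact: subspaceD.
  have tri : 2 * N (U n (y n)) <= N (U n (x n) + U n (y n)) + N (U n (x n) - U n (y n)).
    have := ler_seminormD hq Q2 (subspaceN sP Q1).
    have -> : U n (x n) + U n (y n) - (U n (x n) - U n (y n)) = (2 : R)%:C *: U n (y n).
      rewrite opprB addrC addrA subrK.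
      by rewrite -mulr2n -scaler_nat rmorph_nat.
    by rewrite (seminormN hq Q1) (seminormZ hq)// ger0_norm.
  have := N_ge0 (U n (y n)); lra.
have telescope n k : N (x (n + k)%N - x n) <= 3 / 2 * (3 ^- n - 3 ^- (n + k)).
  elim: k => [|k IH]; first by rewrite addn0 !subrr mulr0 /N (seminorm0 hq).
  have := ler_seminormB_dist hq (Px (n + k.+1)%N) (Px (n + k)%N) (Px n).
  rewrite -/N addnS => tri.
  have e3 : 3 ^- (n + k) = 3 * 3 ^- (n + k).+1 :> R.
    by rewrite exprS; field; rewrite expf_neq0.
  have := dx (n + k)%N; move: tri IH; lra.
have tail n m : (n <= m)%N -> N (x m - x n) <= 3 / 2 * 3 ^- n.
  move=> /subnKC <-; apply: (le_trans (telescope _ _)).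
  have := p3 (n + (m - n))%N; lra.
have cauchy e : 0 < e -> exists K, forall m n, (K <= m)%N -> (K <= n)%N ->
    N (x m - x n) < e.
  move=> e0.
  have [K hK] : exists K, 3 * 3 ^- K < e.
    pose K := (Num.bound (3 / e)).
    exists K; have := archi_boundP (ltW (divr_gt0 (ltr0n _ 3) e0)).
    rewrite -/K => lK.
    have K3 : (K%:R : R) <= 3 ^+ K.
      by rewrite -natrX ler_nat ltnW// ltn_expl.
    rewrite ltr_pdivrMr ?exprn_gt0// mulrC.
    by rewrite -ltr_pdivrMr//; apply: lt_le_trans K3.
  exists K => m n Km Kn.
  have := ler_seminormB_dist hq (Px m) (Px K) (Px n); rewrite -/N.
  have := tail _ _ Km; have := tail _ _ Kn.
  have -> : N (x K - x n) = N (x n - x K) by exact: (seminormBC hq).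
  move: hK; lra.
have [l Pl hl] := Pcomplete Px cauchy.
have near n : N (l - x n) <= 3 / 2 * 3 ^- n.
  apply/ler_addgt0Pr => e e0; have [K hK] := hl e e0.
  pose m := maxn K n.
  have := ler_seminormB_dist hq Pl (Px m) (Px n); rewrite -/N.
  have := hK m (leq_maxl _ _); have := tail _ _ (leq_maxr K n); rewrite -/m.
  have -> : N (x m - l) = N (l - x m) by exact: (seminormBC hq).
  lra.
exists l => // n.
have [_ _ _ big bd] := hf n.
have := ler_seminorm_dist hq (UP n (Px n.+1)) (UP n Pl); rewrite -/N.
have -> : U n (x n.+1) - U n l = U n (x n.+1 - l).
  by rewrite UD ?UN//; exact: subspaceN.
have Pd : P (x n.+1 - l) by exact: subspaceB.
have := bd _ Pd.
have -> : N (x n.+1 - l) = N (l - x n.+1) by exact: (seminormBC hq).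
have := near n.+1; have := Ux n.
have e3 : 3 ^- n = 3 * 3 ^- n.+1 :> R.
  by rewrite exprS; field; rewrite expf_neq0.
(* What survives is 2/3 - 1/2 = 1/6 of 3^-n |U_n|, which is at least n: this is the origin of the 6
   in the hypothesis. *)
rewrite e3; set z := 3 ^- n.+1.
have z0 : 0 < z by exact: p3.
have e3z : 3 ^+ n * (3 * z) = 1 by rewrite /z -e3 divff// expf_neq0.
have bigz : 6 * n%:R <= (f n).1 * (3 * z).
  have -> : 6 * n%:R = 6 * 3 ^+ n * n%:R * (3 * z) :> R.
    by transitivity (6 * n%:R * (3 ^+ n * (3 * z))); [rewrite e3z mulr1|ring].
  by rewrite ler_pM2r// mulr_gt0.
have L0 : 0 <= (f n).1 by apply: le_trans big; rewrite !mulr_ge0// exprn_ge0.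
have := N_ge0 (l - x n.+1); move: (N (l - _)) (f n).1 L0 bigz => d L L0 bigz.
nra.
Qed.

End UniformBoundedness.

(** Continuous induction along [0, t] with an allowed slope e, which then tends to 0. The first
    condition bounds the upper right derivative by 0, the second forbids upward jumps from the
    left. *)
Lemma nonincreasing_of_right_growth (R : realType) (f : R -> R) (t : R) :
  0 <= t ->
  (forall s, 0 <= s < t -> forall e, 0 < e -> exists2 d : R, 0 < d &
     forall h, 0 < h < d -> f (s + h) <= f s + e * h) ->
  (forall s, 0 < s <= t -> forall e, 0 < e -> exists2 d : R, 0 < d &
     forall h, 0 < h < d -> h <= s -> f s <= f (s - h) + e) ->
  f t <= f 0.
Proof.
move=> t0 hr hl.
suff key e : 0 < e -> f t <= f 0 + e * t.
  apply/ler_addgt0Pr => e e0; have t1 : 0 < t + 1 by lra.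
  apply: (le_trans (key _ (divr_gt0 e0 t1))).
  by rewrite lerD2l mulrAC ler_pdivrMr// ler_pM2l//; lra.
move=> e0.
pose A := [set s | 0 <= s <= t /\ forall s', 0 <= s' <= s -> f s' <= f 0 + e * s'].
have A0 : A 0.
  split=> [|s']; first by rewrite lexx.
  by move=> h; have -> : s' = 0 by [lra]; rewrite mulr0 addr0.
have hA : has_sup A.
  by split; [exists 0|exists t => s [/andP[]]].
pose sg := sup A.
have ub s : A s -> s <= sg by exact: sup_upper_bound.
have sg0 : 0 <= sg by exact: ub.
have sgt : sg <= t by apply: ge_sup; [exists 0|move=> s [/andP[]]].
have below s' : 0 <= s' -> s' < sg -> f s' <= f 0 + e * s'.
  move=> s0 ss; have d0 : 0 < sg - s' by rewrite subr_gt0.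
  have [u [_ hu] lu] := sup_adherent d0 hA.
  by apply: hu; rewrite s0 /=; move: lu; rewrite -/sg; lra.
(* The supremum belongs to the set: the bound holds just to its left, and [f] cannot jump up
   there. *)
have at_sg : f sg <= f 0 + e * sg.
  move: (sg0); rewrite le_eqVlt => /orP[/eqP <-|sgp]; first by rewrite mulr0 addr0.
  apply/ler_addgt0Pr => e' e'0.
  have [|d d0 hd] := hl sg _ e' e'0; first by rewrite sgp.
  have h0 : 0 < Num.min (d / 2) (sg / 2) by rewrite lt_min !divr_gt0.
  set h := Num.min _ _ in h0.
  have hd2 : h <= d / 2 by rewrite ge_min lexx.
  have hs2 : h <= sg / 2 by rewrite ge_min lexx orbT.
  have := hd h; rewrite h0 /= => /(_ _ _).
  have := below (sg - h).
  move=> b1 b2.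
  have c1 : f (sg - h) <= f 0 + e * (sg - h) by apply: b1; lra.
  have c2 : f sg <= f (sg - h) + e' by apply: b2; lra.
  have : e * (sg - h) <= e * sg by rewrite ler_pM2l//; lra.
  lra.
have all_sg s' : 0 <= s' <= sg -> f s' <= f 0 + e * s'.
  move=> /andP[s0]; rewrite le_eqVlt => /orP[/eqP ->//|]; exact: below.
move: (sgt); rewrite le_eqVlt => /orP[/eqP <-//|sgt'].
have [|d d0 hd] := hr sg _ e e0; first by rewrite sg0.
have h0 : 0 < Num.min (d / 2) (t - sg) by rewrite lt_min divr_gt0// subr_gt0.
set h := Num.min _ _ in h0.
have hd2 : h <= d / 2 by rewrite ge_min lexx.
have hs2 : h <= t - sg by rewrite ge_min lexx orbT.
(* If sg < t, the right growth condition pushes the set beyond its supremum. *)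
suff /ub : A (sg + h) by lra.
split; first lra.
move=> s' /andP[s0 s1]; have [ss|ss] := leP s' sg; first by apply: all_sg; rewrite s0.
have /hd : 0 < s' - sg < d by lra.
have -> : sg + (s' - sg) = s' by ring.
move=> le; apply: (le_trans le).
by move: at_sg; rewrite mulrBr; lra.
Qed.

(** Reduction to the monotone case for exp(-k s) f(s), since exp(-k h) (1 + k h) <= 1; nonnegativity
    of [f] allows its weights to be replaced by larger ones. *)
Lemma right_gronwall (R : realType) (f : R -> R) (k t : R) :
  0 <= t -> 0 <= k -> (forall s, 0 <= s <= t -> 0 <= f s) ->
  (forall s, 0 <= s < t -> forall e, 0 < e -> exists2 d : R, 0 < d &
     forall h, 0 < h < d -> f (s + h) <= (1 + k * h) * f s + e * h) ->
  (forall s, 0 < s <= t -> forall e, 0 < e -> exists2 d : R, 0 < d &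
     forall h, 0 < h < d -> h <= s -> f s <= f (s - h) + e) ->
  f t <= expR (k * t) * f 0.
Proof.
move=> t0 k0 f0 hr hl.
pose g s := expR (- (k * s)) * f s.
have exp1 s : 0 <= s -> expR (- (k * s)) <= 1.
  by move=> s0; rewrite -expR0 ler_expR oppr_le0 mulr_ge0.
have : g t <= g 0.
  apply: nonincreasing_of_right_growth => // s /andP[s0 st] e e0.
    have [|d d0 hd] := hr s _ e e0; first by rewrite s0.
    exists d => // h hh; have := hd h hh; rewrite /g.
    have -> : - (k * (s + h)) = - (k * s) + - (k * h) by ring.
    rewrite expRD => le1.
    have h0 : 0 < h by case/andP: hh.
    have c1 : expR (- (k * h)) * (1 + k * h) <= 1.
      have := expR_ge1Dx (k * h); have := expR_gt0 (- (k * h)).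
      have : expR (- (k * h)) * expR (k * h) = 1 by rewrite -expRD addNr expR0.
      nra.
    have fs : 0 <= f s by apply: f0; rewrite s0 ltW.
    have c2 := exp1 h (ltW h0).
    have c3 := exp1 s s0.
    have E1 := expR_ge0 (- (k * h)); have E2 := expR_ge0 (- (k * s)).
    have eh : 0 <= e * h by rewrite mulr_ge0// ltW.
    have inner : expR (- (k * h)) * f (s + h) <= f s + e * h.
      apply: (le_trans (ler_wpM2l E1 le1)).
      rewrite mulrDr mulrA; apply: lerD; first by rewrite ler_piMl.
      by rewrite ler_piMl.
    rewrite -mulrA; apply: (le_trans (ler_wpM2l E2 inner)).
    by rewrite mulrDr lerD2l ler_piMl.
  have [|d d0 hd] := hl s _ e e0; first by rewrite s0.
  exists d => // h hh hs; have le1 := hd h hh hs; rewrite /g.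
  have E2 := expR_ge0 (- (k * s)).
  apply: (le_trans (ler_wpM2l E2 le1)); rewrite mulrDr; apply: lerD.
    apply: ler_wpM2r; first by apply: f0; lra.
    by rewrite ler_expR lerN2 ler_wpM2l//; lra.
  by rewrite ler_piMl ?exp1 ?ltW.
rewrite /g mulr0 oppr0 expR0 mul1r => le.
have := ler_wpM2l (expR_ge0 (k * t)) le.
by rewrite mulrA -expRD subrr expR0 mul1r.
Qed.

(** * Orbits of a strongly continuous semigroup *)

Section Semigroup.
Variables (R : realType) (W : lmodType R[i]) (P : set W) (q : W -> W -> R).
Hypothesis hq : semi_inner P q.
Let N := seminorm_of q.
Variables (DG : set W) (G : W -> W) (T : R -> W -> W).
Hypothesis Pcomplete : seminorm_complete P N.
Hypothesis TP : forall t x, 0 <= t -> P x -> P (T t x).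
Hypothesis TL : forall t (c : R[i]) x y, 0 <= t -> P x -> P y ->
  T t (c *: x + y) = c *: T t x + T t y.
Hypothesis TB : forall t, 0 <= t -> exists M : R, forall x, P x ->
  N (T t x) <= M * N x.
Hypothesis T0 : forall x, P x -> T 0 x = x.
Hypothesis TDD : forall t s x, 0 <= t -> 0 <= s -> P x -> T (t + s) x = T t (T s x).
Hypothesis Tcont : forall x, P x -> forall e : R, 0 < e -> exists2 d : R, 0 < d &
  forall h, 0 < h < d -> N (T h x - x) < e.
Hypothesis Tgen : forall x y, P x -> P y ->
  ((forall e : R, 0 < e -> exists2 d : R, 0 < d & forall h, 0 < h < d ->
      N ((h^-1)%:C *: (T h x - x) - y) < e) <-> (DG x /\ y = - G x)).
Hypothesis DGP : forall x, DG x -> P x.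
Hypothesis GP : forall x, DG x -> P (G x).

Let sP : Defs.subspace P. Proof. by case: hq. Qed.
Let N_ge0 x : 0 <= N x. Proof. exact: seminorm_ge0. Qed.

Lemma semigroupB t x y : 0 <= t -> P x -> P y -> T t (x - y) = T t x - T t y.
Proof.
by move=> t0 Px Py; rewrite addrC -scaleN1r TL// scaleN1r addrC.
Qed.

(** Otherwise there are times t_n -> 0 at which |T(t_n)| exceeds the 6 3^n n required by
    [uniform_boundedness]; the resulting x has |T(t_n) x| >= n although T(t_n) x -> x. *)
Lemma semigroup_locally_bounded : exists d M : R, [/\ 0 < d, 0 <= M &
  forall h x, 0 <= h <= d -> P x -> N (T h x) <= M * N x].
Proof.
apply: contrapT => nb.
have ex n : exists tn : R, 0 < tn < n.+1%:R^-1 /\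
    exists2 x, P x & 6 * 3 ^+ n * n%:R * N x < N (T tn x).
  apply: contrapT => hn; apply: nb.
  have n0 : (0 : R) < n.+1%:R^-1 by rewrite invr_gt0 ltr0n.
  have M0 : (0 : R) <= 6 * 3 ^+ n * n%:R by rewrite !mulr_ge0// exprn_ge0.
  (* The summand 1 covers h = 0, where T is the identity while the main constant may be 0. *)
  exists (n.+1%:R^-1 / 2), (6 * 3 ^+ n * n%:R + 1); split; [by rewrite divr_gt0|by rewrite addr_ge0|].
  move=> h x /andP[h0 h1] Px.
  have Nx := N_ge0 x.
  move: h0; rewrite le_eqVlt => /orP[/eqP <-|h0].
    by rewrite T0//; have := mulr_ge0 M0 Nx; lra.
  suff : N (T h x) <= 6 * 3 ^+ n * n%:R * N x by lra.
  rewrite leNgt; apply/negP => lt; apply: hn; exists h; split.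
    by rewrite h0 /= (le_lt_trans h1)// ltr_pdivrMr// ltr_pMr// ltr1n.
  by exists x.
have [tn htn] := choice ex.
have tn0 n : 0 <= tn n by case: (htn n) => /andP[/ltW].
have [||||x Px hx] := @uniform_boundedness _ _ _ _ hq Pcomplete (fun n => T (tn n)).
- by move=> n x; apply: TP.
- by move=> n c x y; apply: TL.
- by move=> n; apply: TB.
- by move=> n; case: (htn n).
have [d d0 hd] := Tcont Px ltr01.
pose n := maxn (Num.bound (d^-1)) (Num.bound (N x + 1)).
have le1 : d^-1 < n.+1%:R.
  apply: (lt_le_trans (archi_boundP _)); first by rewrite invr_ge0 ltW.
  by rewrite ler_nat (leq_trans _ (leqnSn _))// leq_maxl.
have le2 : N x + 1 < n%:R.
  apply: (lt_le_trans (archi_boundP _)); first by rewrite addr_ge0.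
  by rewrite ler_nat leq_maxr.
have small : 0 < tn n < d.
  have [/andP[-> lt] _] := htn n; apply: (lt_trans lt).
  by rewrite -[d]invrK ltf_pV2// posrE ?invr_gt0// ltr0n.
have := hd _ small; have := hx n; rewrite -/N.
have := ler_seminorm_dist hq (TP (tn0 n) Px) Px; rewrite -/N.
move: le2; lra.
Qed.

(** T(s) x - T(s - h) x = T(k - h) (T(h) y - y), where y = T(s - k) x does not depend on h. So right
    continuity at 0 of one orbit suffices, and k = min(s, d) keeps k - h where T is uniformly
    bounded. *)
Lemma semigroup_left_continuous x s e : P x -> 0 < s -> 0 < e ->
  exists2 d : R, 0 < d & forall h, 0 < h < d -> h <= s ->
    N (T s x - T (s - h) x) < e.
Proof.
move=> Px s0 e0.
have [d [M [d0 M0 hM]]] := semigroup_locally_bounded.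
pose k := Num.min s d.
have k0 : 0 < k by rewrite lt_min s0.
have ks : k <= s by rewrite ge_min lexx.
have kd : k <= d by rewrite ge_min lexx orbT.
have sk : 0 <= s - k by rewrite subr_ge0.
have Py := TP sk Px; set y := T (s - k) x in Py.
have M1 : 0 < M + 1 by lra.
have [d' d'0 hd'] := Tcont Py (divr_gt0 e0 M1).
exists (Num.min d' k); first by rewrite lt_min d'0.
move=> h /andP[h0]; rewrite lt_min => /andP[hd1 hk] hs.
have kh : 0 <= k - h by rewrite subr_ge0 ltW.
have Ph : P (T h y) by apply: TP => //; exact: ltW.
have e1 : T s x = T (k - h) (T h y).
  rewrite -TDD ?(ltW h0)// -TDD//; last lra.
  by congr (T _ x); ring.
have e2 : T (s - h) x = T (k - h) y.
  by rewrite -TDD//; congr (T _ x); ring.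
rewrite e1 e2 -semigroupB//.
have /hd' : 0 < h < d' by rewrite h0.
have Pd : P (T h y - y) by exact: subspaceB.
have /hM/(_ Pd) : 0 <= k - h <= d by lra.
move=> le lt; apply: (le_lt_trans le).
move: lt; rewrite ltr_pdivlMr// => lt.
by have := N_ge0 (T h y - y); nra.
Qed.

(** The difference quotient at T(s) x is T(s) applied to the one at x. As T(s) is bounded, the limit
    exists, and its existence characterises membership in [DG]. *)
Lemma semigroup_domain x s : DG x -> 0 <= s -> DG (T s x).
Proof.
move=> Dx s0; have Px := DGP Dx; have PGx := GP Dx.
have PNG : P (- G x) by exact: subspaceN.
have PTx := TP s0 Px; have PTG := TP s0 PNG.
suff : DG (T s x) /\ T s (- G x) = - G (T s x) by case.
apply/(Tgen PTx PTG) => e e0.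
have [M hM] := TB s0.
have M1 : 0 < `|M| + 1 by rewrite ltr_wpDl.
have [_ /(_ (conj Dx erefl))] := Tgen Px PNG.
move=> /(_ _ (divr_gt0 e0 M1))[d d0 hd]; exists d => // h hh.
have h0 : 0 <= h by case/andP: hh => /ltW.
have PTh := TP h0 Px.
have Pq : P ((h^-1)%:C *: (T h x - x)) by apply: subspaceZ => //; exact: subspaceB.
have -> : (h^-1)%:C *: (T h (T s x) - T s x) - T s (- G x)
  = T s ((h^-1)%:C *: (T h x - x) - (- G x)).
  rewrite semigroupB//; congr (_ - _).
  have Pd : P (T h x - x) by exact: subspaceB.
  rewrite -[_ *: (T h x - x)]addr0 TL//; last exact: subspace0.
  have -> : T s 0 = 0 by rewrite -{1}(subrr x) semigroupB// subrr.
  by rewrite addr0 semigroupB// -!TDD// (addrC h s).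
have Pr : P ((h^-1)%:C *: (T h x - x) - - G x) by exact: subspaceB.
apply: (le_lt_trans (hM _ Pr)).
have := hd h hh; rewrite ltr_pdivlMr//.
have := N_ge0 ((h^-1)%:C *: (T h x - x) - - G x).
have := ler_norm M; nra.
Qed.

Lemma semigroup_right_derivative x s e : DG x -> 0 <= s -> 0 < e ->
  exists2 d : R, 0 < d & forall h, 0 < h < d -> exists r : W,
    [/\ P r, N r < e & T (s + h) x = T s x + h%:C *: (- G (T s x) + r)].
Proof.
move=> Dx s0 e0; have Dy := semigroup_domain Dx s0.
have Px := DGP Dx; set y := T s x in Dy *.
have Py := DGP Dy; have PG : P (- G y) by apply: subspaceN => //; exact: GP.
have [_ /(_ (conj Dy erefl) _ e0)[d d0 hd]] := Tgen Py PG.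
exists d => // h hh; have h0 : 0 < h by case/andP: hh.
have PTh := TP (ltW h0) Py.
exists ((h^-1)%:C *: (T h y - y) - - G y); split; last first.
- rewrite addrCA subrr addr0 scalerA -rmorphM /= divff ?gt_eqF// scale1r.
  by rewrite [RHS]addrC subrK (addrC s) TDD// ltW.
- exact: hd.
- by apply: subspaceB => //; apply: subspaceZ => //; exact: subspaceB.
Qed.

(** Expanding the energy of y + h (z + r), with z = - G y and a small remainder r, gives the growth
    condition of [right_gronwall] with k = 2 mu. Errors are measured in [N], which dominates the
    energy seminorm. *)
Lemma semigroup_energy_growth (qE : W -> W -> R) (mu t : R) x :
  semi_inner P qE -> (forall y, P y -> qE y y <= q y y) -> 0 <= mu ->
  (forall y, DG y -> qE y (- G y) <= mu * qE y y) ->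
  DG x -> 0 <= t -> qE (T t x) (T t x) <= expR (2 * mu * t) * qE x x.
Proof.
move=> hE leE mu0 diss Dx t0; have Px := DGP Dx.
pose NE := seminorm_of qE.
have NE0 y : 0 <= NE y by exact: seminorm_ge0.
have NEN y : P y -> NE y <= N y by move=> Py; rewrite ler_wsqrtr// leE.
have E0 y : P y -> 0 <= qE y y by case: hE => _ _ _ _; apply.
pose f s := NE (T s x) ^+ 2.
have fE s : 0 <= s -> f s = qE (T s x) (T s x).
  by move=> s0; apply: (seminorm_sqr hE); exact: TP.
suff : f t <= expR (2 * mu * t) * f 0 by rewrite !fE// T0.
apply: right_gronwall => // [|s _|s /andP[s0 st] e e0|s /andP[s0 st] e e0].
- by rewrite mulr_ge0.
- exact: sqr_ge0.
- have Dy := semigroup_domain Dx s0; set y := T s x in Dy.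
  have Py := DGP Dy; have PG : P (- G y) by apply: subspaceN => //; exact: GP.
  set z := - G y in PG.
  have Ny := N_ge0 y; have Nz := N_ge0 z.
  (* |r| < 1 gives |z + r| <= |z| + 1; the other entry gives 2 |y| |r| <= e/2, and the bound on h
     chosen below gives h |z + r|^2 <= e/2. *)
  have r0 : 0 < Num.min 1 (e / (4 * (N y + 1))).
    by rewrite lt_min ltr01 divr_gt0// mulr_gt0//; lra.
  have [d d0 hd] := semigroup_right_derivative Dx s0 r0.
  have c0 : 0 < 2 * (N z + 1) ^+ 2 by rewrite mulr_gt0// exprn_gt0//; lra.
  exists (Num.min d (e / (2 * (N z + 1) ^+ 2))); first by rewrite lt_min d0 divr_gt0.
  move=> h /andP[h0]; rewrite lt_min => /andP[hd1 hd2].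
  have [|r [Pr Nr eT]] := hd h; first by rewrite h0.
  move: Nr; rewrite lt_min => /andP[Nr1 Nr2].
  rewrite /f eT -/y -/z.
  have Pzr : P (z + r) by exact: subspaceD.
  rewrite /NE (seminorm_sqrDZ hE)// (semi_innerDr hE)// -/NE.
  have ds : qE y z <= mu * NE y ^+ 2 by rewrite (seminorm_sqr hE)//; exact: diss.
  have cs : qE y r <= N y * N r.
    apply: (le_trans (semi_inner_CS hE Py Pr)).
    by apply: ler_pM; rewrite ?NEN//; exact: NE0.
  have bz : NE (z + r) <= N z + 1.
    apply: (le_trans (NEN _ Pzr)); apply: (le_trans (ler_seminormD hq PG Pr)).
    by rewrite lerD2l ltW.
  have bz2 : NE (z + r) ^+ 2 <= (N z + 1) ^+ 2.
    by rewrite ler_sqr ?nnegrE//; lra.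
  move: Nr2; rewrite ltr_pdivlMr; last lra.
  move=> Nr2; move: hd2; rewrite ltr_pdivlMr// => hd2.
  have Nr0 := N_ge0 r.
  have a1 : 2 * (N y * N r) <= e / 2 by nra.
  have a2 : h * NE (z + r) ^+ 2 <= e / 2 by nra.
  suff : h * (2 * (qE y z + qE y r) + h * NE (z + r) ^+ 2)
    <= h * (2 * mu * NE y ^+ 2 + e) by lra.
  by rewrite ler_pM2l//; lra.
have Ps := TP (ltW s0) Px.
pose b := NE (T s x).
have b0 : 0 <= b by exact: NE0.
(* Let c be the energy seminorm at s - h. If c < b then b^2 - c^2 <= 2 b (b - c), so a variation
   below e / (2 b + 1) is enough. *)
have b1 : 0 < 2 * b + 1 by lra.
have [d d0 hd] := semigroup_left_continuous Px s0 (divr_gt0 e0 b1).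
exists d => // h hh hs.
have sh : 0 <= s - h by rewrite subr_ge0.
have Psh := TP sh Px.
have Pd : P (T s x - T (s - h) x) by exact: subspaceB.
have := hd h hh hs; rewrite ltr_pdivlMr// => lt.
have := ler_seminorm_dist hE Ps Psh; rewrite -/NE.
have := NEN _ Pd; rewrite /f -/b.
have := NE0 (T (s - h) x); have := NE0 (T s x - T (s - h) x).
move: (NE (T (s - h) x)) (NE _) (N _) lt => c dl D lt dl0 c0 dlD bc.
have [le|lt'] := leP b c; first by nra.
have : (b - c) * (b + c) <= dl * (2 * b) by apply: ler_pM; lra.
nra.
Qed.

(** A mean value inequality for bounded real functionals, which have right derivatives along the
    orbit even where its norm vanishes. *)
Lemma semigroup_functional_growth (phi : W -> R) (K c t : R) x :
  (forall y z, P y -> P z -> phi (y + z) = phi y + phi z) ->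
  (forall (r : R) y, P y -> phi (r%:C *: y) = r * phi y) ->
  (forall y, P y -> phi y <= K * N y) -> 0 <= K ->
  DG x -> 0 <= t -> (forall s, 0 <= s <= t -> phi (- G (T s x)) <= c) ->
  phi (T t x) <= phi x + c * t.
Proof.
move=> phiD phiZ phiK K0 Dx t0 hc; have Px := DGP Dx.
have K1 : 0 < K + 1 by lra.
suff : phi (T t x) - c * t <= phi (T 0 x) - c * 0 by rewrite T0//; lra.
apply: (@nonincreasing_of_right_growth _ (fun s => phi (T s x) - c * s)) => //.
- move=> s /andP[s0 st] e e0.
  have [d d0 hd] := semigroup_right_derivative Dx s0 (divr_gt0 e0 K1).
  exists d => // h hh; have [r [Pr Nr ->]] := hd h hh.
  have h0 : 0 < h by case/andP: hh.
  have Dy := semigroup_domain Dx s0; have Py := DGP Dy.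
  have PG : P (- G (T s x)) by apply: subspaceN => //; exact: GP.
  have PGr : P (- G (T s x) + r) by exact: subspaceD.
  rewrite phiD ?phiZ ?phiD//; last exact: subspaceZ.
  have := hc s; rewrite s0 (ltW st) => /(_ isT) le1.
  have le2 : phi r <= e.
    apply: (le_trans (phiK _ Pr)); move: Nr; rewrite ltr_pdivlMr//.
    have := N_ge0 r; nra.
  have : h * (phi (- G (T s x)) + phi r) <= h * (c + e).
    by rewrite ler_pM2l// lerD.
  lra.
move=> s /andP[s0 st] e e0.
have c1 : 0 < 2 * (`|c| + 1) by rewrite mulr_gt0// ltr_wpDl.
have K2 : 0 < 2 * (K + 1) by lra.
have [d d0 hd] := semigroup_left_continuous Px s0 (divr_gt0 e0 K2).
(* Half of e pays for the variation of the orbit, half for the drift c h, where c may have either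
   sign. *)
exists (Num.min d (e / (2 * (`|c| + 1)))); first by rewrite lt_min d0 divr_gt0.
move=> h /andP[h0]; rewrite lt_min => /andP[h1 h2] hs.
have sh : 0 <= s - h by rewrite subr_ge0.
have Psh := TP sh Px; have Ps := TP (ltW s0) Px.
have Pd : P (T s x - T (s - h) x) by exact: subspaceB.
have /hd/(_ hs) : 0 < h < d by rewrite h0.
have -> : T s x = T (s - h) x + (T s x - T (s - h) x) by rewrite addrC subrK.
rewrite phiD//; have := phiK _ Pd; have := N_ge0 (T s x - T (s - h) x).
rewrite [X in N X < _]addrC addKr.
rewrite ltr_pdivlMr//; move: h2; rewrite ltr_pdivlMr// => h2.
have cN : - c * h <= `|c| * h by rewrite ler_pM2r// -normrN ler_norm.
set D := N _; set p := phi (_ - _); set p' := phi _.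
move=> D0 pK DK.
have : K * D <= e / 2 by nra.
have : `|c| * h <= e / 2 by lra.
lra.
Qed.

End Semigroup.

(** * The real part of the inner product, and self-adjoint operators *)

Section HilbertSpace.
Variables (R : realType) (V : lmodType R[i]) (ip : V -> V -> R[i]).
Hypothesis hip : is_inner_product ip.

Definition rip (x y : V) : R := complex.Re (ip x y).

Lemma ReZ (r : R) (z : R[i]) : complex.Re (r%:C * z) = r * complex.Re z.
Proof. by case: z => u v /=; rewrite mul0r subr0. Qed.

Lemma ReD (y z : R[i]) : complex.Re (y + z) = complex.Re y + complex.Re z.
Proof. by case: y z => [? ?] [? ?]. Qed.

Lemma ipDr x y z : ip x (y + z) = ip x y + ip x z.
Proof. by case: hip => h _; rewrite -{1}[y]scale1r h mul1r. Qed.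

Lemma ipr0 x : ip x 0 = 0.
Proof. by apply: (addIr (ip x 0)); rewrite -ipDr addr0 add0r. Qed.

Lemma ipZr a x y : ip x (a *: y) = a * ip x y.
Proof. by case: hip => h _; rewrite -[a *: y]addr0 h ipr0 addr0. Qed.

Lemma ip_conj x y : ip y x = (ip x y)^*.
Proof. by case: hip => _ [h _]. Qed.

Lemma ripC x y : rip x y = rip y x.
Proof. by rewrite /rip (ip_conj x y); case: (ip x y). Qed.

Lemma ripZr r x y : rip x (r%:C *: y) = r * rip x y.
Proof. by rewrite /rip ipZr ReZ. Qed.

Lemma ripDr x y z : rip x (y + z) = rip x y + rip x z.
Proof. by rewrite /rip ipDr ReD. Qed.

Lemma rip_iZr x y : rip x ('i *: y) = - complex.Im (ip x y).
Proof. by rewrite /rip ipZr mulrC ReiNIm. Qed.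

Lemma rip_semi_inner : semi_inner setT rip.
Proof.
split=> //.
- by move=> x y z _ _ _; rewrite ripC ripDr !(ripC z).
- by move=> r x y _ _; rewrite ripC ripZr ripC.
- by move=> x y _ _; exact: ripC.
- by move=> x _; case: hip => _ [_ [h _]]; exact: h.
Qed.

Lemma hnormE x : hnorm ip x = seminorm_of rip x.
Proof. by []. Qed.

Lemma hnorm_eq0 x : hnorm ip x = 0 -> x = 0.
Proof.
move=> x0; case: hip => _ [_ [_]]; apply.
have : rip x x = 0 by rewrite -(seminorm_sqr rip_semi_inner)// -hnormE x0 expr0n.
have : complex.Im (ip x x) = 0.
  by have := ip_conj x x; case: (ip x x) => u v [] /=; lra.
by rewrite /rip; case: (ip x x) => u v /= -> ->.
Qed.

Lemma hnorm_iZ x : hnorm ip ('i *: x) = hnorm ip x.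
Proof.
rewrite /hnorm -/(rip _ _) rip_iZr ip_conj ipZr -/(rip x x) /rip.
by case: (ip x x) => u v /=; congr Num.sqrt; ring.
Qed.

Lemma self_adjoint_sym D A x y : self_adjoint ip D A -> D x -> D y ->
  ip (A x) y = ip x (A y).
Proof. by move=> [_ h] Dx Dy; have [_] := h y (A y); apply. Qed.

(* Testing with z and 'i z recovers the complex adjoint identity from its real part. *)
Lemma self_adjoint_real D A y w : self_adjoint ip D A ->
  (forall z, D z -> rip (A z) y = rip z w) -> D y /\ A y = w.
Proof.
move=> [[sD [_ lA]] sa] h; apply/sa => z Dz.
have AiZ : A ('i *: z) = 'i *: A z.
  have [D0 _] := sD.
  rewrite -[X in A X]addr0 lA//.
  suff -> : A 0 = 0 by rewrite addr0.
  by have := lA (-1) _ _ D0 D0; rewrite scaler0 addr0 scaleN1r addNr.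
have iz : D ('i *: z) by exact: subspaceZ.
have := h _ iz; have := h _ Dz.
rewrite AiZ 2!(ripC ('i *: _)) !rip_iZr (ip_conj (A z)) (ip_conj z) /rip.
by case: (ip (A z) y) (ip z w) => [a1 b1] [a2 b2] /= -> /oppr_inj/oppr_inj ->.
Qed.

(** The identity <A z|x_n> = <z|A x_n> passes to the limit for every z in the domain, and the limit
    identity characterises the graph of A. *)
Lemma self_adjoint_closed D A (x : nat -> V) y w : self_adjoint ip D A ->
  (forall n, D (x n)) ->
  (forall e : R, 0 < e -> exists K : nat, forall n, (K <= n)%N ->
     hnorm ip (x n - y) < e) ->
  (forall e : R, 0 < e -> exists K : nat, forall n, (K <= n)%N ->
     hnorm ip (A (x n) - w) < e) ->
  D y /\ A y = w.
Proof.
move=> sa Dx xy Axw; apply: (self_adjoint_real sa) => z Dz.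
have hq := rip_semi_inner.
have NAz := seminorm_ge0 rip (A z); have Nz := seminorm_ge0 rip z.
set p := seminorm_of rip (A z) in NAz; set r := seminorm_of rip z in Nz.
have c0 : 0 < p + r + 1 by lra.
apply/eqP; rewrite -subr_eq0 -normr_eq0 eq_le normr_ge0 andbT.
apply/ler_addgt0Pr => e e0; rewrite add0r.
have [K1 h1] := xy _ (divr_gt0 e0 c0); have [K2 h2] := Axw _ (divr_gt0 e0 c0).
have {h1} := h1 _ (leq_maxl K1 K2); have {h2} := h2 _ (leq_maxr K1 K2).
set n := maxn _ _; rewrite !hnormE !ltr_pdivlMr// => h2 h1.
have sym : rip (A z) (x n) = rip z (A (x n)) by rewrite /rip (self_adjoint_sym sa).
have cs1 := semi_inner_CS hq (I : setT (A z)) (I : setT (x n - y)).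
have cs2 := semi_inner_CS hq (I : setT z) (I : setT (A (x n) - w)).
have cs1' := semi_inner_CS hq (I : setT (A z)) (I : setT (- (x n - y))).
have cs2' := semi_inner_CS hq (I : setT z) (I : setT (- (A (x n) - w))).
rewrite (seminormN hq)// (semi_innerNr hq)// in cs1'.
rewrite (seminormN hq)// (semi_innerNr hq)// in cs2'.
move: cs1 cs2 cs1' cs2'; rewrite !ripDr !(semi_innerNr hq)// sym -/p -/r.
move: h1 h2; have := seminorm_ge0 rip (x n - y).
have := seminorm_ge0 rip (A (x n) - w).
move: (seminorm_of _ _) (seminorm_of _ _) (rip _ _) (rip _ _) (rip _ _).
move=> d1 d2 u v g g1 g2 g3 g4 g5 g6 g7 g8.
have : p * d1 + r * d2 <= e by nra.
by rewrite ler_norml; lra.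
Qed.

(** * Coercive self-adjoint operators and their square roots *)

Section CoerciveOperator.
Hypothesis hcomp : hcomplete ip.
Variables (D : set V) (A : V -> V) (eps : R).
Hypothesis sa : self_adjoint ip D A.
Hypothesis eps0 : 0 < eps.
Hypothesis coercive : forall x, D x -> eps%:C * ip x x <= ip x (A x).

Lemma coercive_lower_bound x : D x -> eps * hnorm ip x <= hnorm ip (A x).
Proof.
move=> Dx; have hq := rip_semi_inner.
have := coercive Dx; rewrite lecE => /andP[_]; rewrite ReZ.
rewrite -/(rip x x) -/(rip x (A x)) -(seminorm_sqr hq)// => h.
have := le_trans h (semi_inner_CS hq (I : setT x) (I : setT (A x))).
rewrite !hnormE => {}h.
have := seminorm_ge0 rip x; rewrite le_eqVlt => /orP[/eqP <-|x0].
  by rewrite mulr0 seminorm_ge0.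
by rewrite -(ler_pM2l x0); apply: le_trans h; rewrite le_eqVlt; apply/orP; left; apply/eqP; ring.
Qed.

(* The minimiser [x] of |A x - f| exists by the parallelogram law, and its
   residual lies in the orthogonal of the range, which is the kernel of [A]. *)
Lemma coercive_surjective f : exists2 x, D x & A x = f.
Proof.
have hq := rip_semi_inner.
pose N := hnorm ip.
have N0 x : 0 <= N x by exact: (seminorm_ge0 (rip)).
have [[sD [_ lA]] _] := sa; have D0 := subspace0 sD.
have AD x y : D x -> D y -> A (x + y) = A x + A y.
  by move=> Dx Dy; rewrite -{1}[x]scale1r lA// scale1r.
have A0 : A 0 = 0.
  by have := lA (-1) _ _ D0 D0; rewrite scaler0 addr0 scaleN1r addNr.
have AZ c x : D x -> A (c *: x) = c *: A x.
  by move=> Dx; rewrite -[c *: x]addr0 lA// A0 addr0.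
have AB x y : D x -> D y -> A (x - y) = A x - A y.
  move=> Dx Dy; have Dn := subspaceN sD Dy.
  by rewrite AD// -(scaleN1r y) AZ// scaleN1r.
pose J := [set r | exists2 x, D x & r = N (A x - f) ^+ 2].
have hJ : has_inf J.
  split; first by exists (N (A 0 - f) ^+ 2), 0.
  by exists 0 => r [x _ ->]; exact: sqr_ge0.
pose m := inf J.
have mle x : D x -> m <= N (A x - f) ^+ 2.
  by move=> Dx; apply: ge_inf; [case: hJ|exists x].
have ex n : exists x, D x /\ N (A x - f) ^+ 2 < m + n.+1%:R^-1.
  have n0 : (0 : R) < n.+1%:R^-1 by rewrite invr_gt0 ltr0n.
  by have [r [x Dx ->] lt] := inf_adherent n0 hJ; exists x.
have [x hx] := choice ex.
have Dx n : D (x n) by case: (hx n).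
have small e : 0 < e -> exists K : nat, forall n, (K <= n)%N -> n.+1%:R^-1 < e :> R.
  move=> e0; exists (Num.bound e^-1) => n Kn.
  rewrite -[e]invrK ltf_pV2 ?posrE ?invr_gt0// ?ltr0n//.
  apply: (lt_le_trans (archi_boundP _)); first by rewrite invr_ge0 ltW.
  by rewrite ler_nat (leq_trans Kn).
have cauA e : 0 < e -> exists K : nat, forall i j, (K <= i)%N -> (K <= j)%N ->
    N (A (x i) - A (x j)) < e.
  (* Two squared residuals within e^2 / 4 of the infimum, and a midpoint not below it, give |A x_i -
     A x_j|^2 < e^2. *)
  move=> e0; have e2 : 0 < e ^+ 2 / 4 by rewrite divr_gt0// exprn_gt0.
  have [K hK] := small _ e2; exists K => i j Ki Kj.
  rewrite -ltr_sqr ?nnegrE ?(ltW e0)//.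
  have := seminorm_parallelogram hq (I : setT (A (x i) - f)) (I : setT (A (x j) - f)).
  have -> : A (x i) - f - (A (x j) - f) = A (x i) - A (x j).
    by rewrite opprB addrA subrK.
  have -> : A (x i) - f + (A (x j) - f)
      = (2 : R)%:C *: (A ((2^-1)%:C *: (x i + x j)) - f).
    rewrite AZ; last exact: subspaceD.
    rewrite AD// scalerBr scalerA -rmorphM /= divff// scale1r.
    by rewrite rmorph_nat scaler_nat mulr2n opprD addrACA.
  rewrite (seminormZ hq)// -!hnormE -/N ger0_norm// exprMn.
  have Dm : D ((2^-1)%:C *: (x i + x j)) by apply: subspaceZ => //; exact: subspaceD.
  have := mle _ Dm; have [_] := hx i; have [_] := hx j.
  have := hK _ Ki; have := hK _ Kj.
  move: (i.+1%:R^-1) (j.+1%:R^-1) => a b; lra.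
have [g hg] := hcomp cauA.
(* Coercivity transfers the Cauchy property from [A (x n)] to [x n]; closedness then yields A y =
   g. *)
have caux e : 0 < e -> exists K : nat, forall i j, (K <= i)%N -> (K <= j)%N ->
    hnorm ip (x i - x j) < e.
  move=> e0; have [K hK] := cauA _ (mulr_gt0 eps0 e0); exists K => i j Ki Kj.
  have := hK i j Ki Kj; rewrite -AB// => lt.
  have := le_lt_trans (coercive_lower_bound (subspaceB sD (Dx i) (Dx j))) lt.
  by rewrite ltr_pM2l.
have [y hy] := hcomp caux.
have [Dy Ay] := self_adjoint_closed sa Dx hy hg.
exists y => //; rewrite Ay.
pose p := N (g - f).
have pm : p ^+ 2 <= m.
  rewrite leNgt; apply/negP => lt.
  have p0 : 0 <= p by exact: N0.
  have c0 : 0 < 4 * p + 4 by lra.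
  have d0 : 0 < p ^+ 2 - m by rewrite subr_gt0.
  have [K1 h1] := hg _ (divr_gt0 d0 c0).
  have [K2 h2] := small _ (divr_gt0 d0 (ltr0n _ 2)).
  pose n := maxn K1 K2.
  have := h1 n (leq_maxl _ _); rewrite ltr_pdivlMr// -/N => dn.
  have := h2 n (leq_maxr _ _); rewrite ltr_pdivlMr// => bn.
  have [_ cn] := hx n.
  have := ler_seminormB_dist hq (I : setT g) (I : setT (A (x n))) (I : setT f).
  rewrite (seminormBC hq (I : setT g) (I : setT (A (x n)))) -!hnormE -/N -/p.
  have := N0 (A (x n) - f); have := N0 (A (x n) - g).
  move: (N (A (x n) - f)) (N (A (x n) - g)) (n.+1%:R^-1) dn bn cn.
  move=> c d b dn bn cn d0' c0' tri.
  have : p ^+ 2 <= c ^+ 2 + 2 * p * d.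
    have [le|lt'] := leP p c; first by nra.
    have : (p - c) * (p + c) <= d * (2 * p) by apply: ler_pM; lra.
    by lra.
  have : 2 * p * d <= (p ^+ 2 - m) / 2 by lra.
  lra.
(* The first-order condition, written as an adjoint identity so that [self_adjoint_real] puts g - f
   in the domain with A (g - f) = 0. *)
have orth z : D z -> rip (A z) (g - f) = rip z 0.
  move=> Dz; rewrite {2}/rip ipr0 /= ripC.
  set b := rip _ _; set c := N (A z) ^+ 2.
  have c0 : 0 <= c by exact: sqr_ge0.
  have c1 : c + 1 != 0 by rewrite gt_eqF//; lra.
  (* Moving by -k z changes the squared residual by k^2 c - 2 k b = - k^2 (c + 2), so k = 0. Using c
     + 1 in place of the optimal c avoids a division by 0. *)
  pose k := b / (c + 1).
  have Dkz : D ((- k)%:C *: z) by exact: subspaceZ.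
  have : p ^+ 2 <= N (A (y + (- k)%:C *: z) - f) ^+ 2.
    by apply: (le_trans pm); apply: mle; exact: subspaceD.
  rewrite AD ?AZ ?Ay//.
  rewrite addrAC [N (_ + _)]hnormE (seminorm_sqrDZ hq)// -!hnormE -/N -/b -/c -/p.
  have -> : b = k * (c + 1) by rewrite /k divfK.
  move=> h; have k2 : k ^+ 2 * (c + 2) <= 0 by lra.
  have : k ^+ 2 = 0 by have := sqr_ge0 k; nra.
  by move/eqP; rewrite sqrf_eq0 => /eqP ->; rewrite mul0r.
have [Dw Aw] := self_adjoint_real sa orth.
have := coercive_lower_bound Dw; rewrite Aw [hnorm ip 0](seminorm0 hq) => h.
apply/eqP; rewrite -subr_eq0; apply/eqP/hnorm_eq0/eqP.
by rewrite eq_le [0 <= _]N0 andbT -(ler_pM2l eps0) mulr0.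
Qed.

Variables (DS : set V) (S : V -> V).
Hypothesis hS : is_pos_sqrt ip D A DS S.

Lemma pos_sqrt_surjective f : exists2 x, DS x & S x = f.
Proof.
have [_ [_ [DDS SS]]] := hS.
have [y Dy Ay] := coercive_surjective f.
by exists (S y); [case/DDS: Dy|rewrite SS].
Qed.

(** |S x|^2 = <x|A x> makes sense only on [D]. For x in [DS], solve A y = S x; then x = S y, so
    |x|^2 = <y|S x> <= |y| |S x|, while eps |y| <= |A y| = |S x|. *)
Lemma pos_sqrt_lower_bound x : DS x -> eps * hnorm ip x ^+ 2 <= hnorm ip (S x) ^+ 2.
Proof.
move=> DSx; have hq := rip_semi_inner.
have [saS [_ [DDS SS]]] := hS; have [[sDS [_ lS]] _] := saS.
have [y Dy Ay] := coercive_surjective (S x).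
have [DSy DSSy] := (DDS y).1 Dy.
(* The difference lies in the kernel of S, hence in [D] and in the kernel of A, which is trivial. *)
have xy : x = S y.
  have DSd : DS (x - S y) by exact: subspaceB.
  have Sd : S (x - S y) = 0.
    by rewrite addrC -scaleN1r lS// SS// Ay scaleN1r addNr.
  have DS0 := subspace0 sDS.
  have S0 : S 0 = 0.
    by have := lS (-1) _ _ DS0 DS0; rewrite scaler0 addr0 scaleN1r addNr.
  have Dd : D (x - S y) by apply/DDS; rewrite Sd.
  have := coercive_lower_bound Dd; rewrite -SS// Sd S0 [hnorm ip 0](seminorm0 hq) => h.
  apply/eqP; rewrite -subr_eq0; apply/eqP/hnorm_eq0/eqP.
  by rewrite eq_le [0 <= _](seminorm_ge0 rip) andbT -(ler_pM2l eps0) mulr0.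
have := coercive_lower_bound Dy; rewrite Ay => h1.
have : hnorm ip x ^+ 2 <= hnorm ip y * hnorm ip (S x).
  rewrite !hnormE (seminorm_sqr hq)//.
  apply: le_trans (semi_inner_CS hq (I : setT y) (I : setT (S x))).
  by rewrite {1 2}xy /rip (self_adjoint_sym saS)// SS// Ay.
move=> h2.
have Nx : 0 <= hnorm ip (S x) by exact: (seminorm_ge0 rip).
apply: (le_trans (ler_wpM2l (ltW eps0) h2)).
by rewrite mulrA expr2 ler_wpM2r.
Qed.

End CoerciveOperator.
End HilbertSpace.

(** * The space Y, the energy form and the generator *)

Section EnergySpace.
Variables (R : realType) (V : lmodType R[i]) (ip : V -> V -> R[i]).
Hypothesis hip : is_inner_product ip.
Hypothesis hcomp : hcomplete ip.
Variables (eps : R) (D : set V) (A : V -> V) (DS : set V) (S : V -> V).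
Hypothesis eps0 : 0 < eps.
Hypothesis sa : self_adjoint ip D A.
Hypothesis coercive : forall x, D x -> eps%:C * ip x x <= ip x (A x).
Hypothesis hS : is_pos_sqrt ip D A DS S.

Local Notation rip := (rip ip).
Local Notation norm := (hnorm ip).

Definition ripY (x y : V * V) : R := rip (S x.1) (S y.1) + rip x.2 y.2.

(* The polar form of <x1|A0 x1> + |x2|^2, extended to Y; here A0 = A - eps. *)
Definition energy (x y : V * V) : R := ripY x y - eps * rip x.1 y.1.

Let hq := rip_semi_inner hip.
Let saS : self_adjoint ip DS S. Proof. by case: hS. Qed.
Let sDS : Defs.subspace DS. Proof. by case: saS => [[]]. Qed.
Let lS : linear_on DS S. Proof. by case: saS => [[_ []]]. Qed.

Let SD x y : DS x -> DS y -> S (x + y) = S x + S y.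
Proof. by move=> Dx Dy; rewrite -{1}[x]scale1r lS// scale1r. Qed.

Let SZ c x : DS x -> S (c *: x) = c *: S x.
Proof.
move=> Dx; have D0 := subspace0 sDS.
have S0 : S 0 = 0.
  by have := lS (-1) D0 D0; rewrite scaler0 addr0 scaleN1r addNr.
by rewrite -[c *: x]addr0 lS// S0 addr0.
Qed.

Lemma normYE x : normY ip S x = seminorm_of ripY x.
Proof. by rewrite /normY !hnormE !(seminorm_sqr hq). Qed.

Lemma subspaceY : Defs.subspace (inY DS : set (V * V)%type).
Proof.
split; first exact: (subspace0 sDS).
by move=> c x y Dx Dy; case: sDS => _; exact.
Qed.

Lemma ripY_semi_inner : semi_inner (inY DS : set (V * V)%type) ripY.
Proof.
split; first exact: subspaceY.
- move=> x y z Dx Dy Dz; rewrite /ripY /= SD// !(semi_innerDl hq)//; ring.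
- move=> r x y Dx Dy; rewrite /ripY /= SZ// !(semi_innerZl hq)//; ring.
- by move=> x y Dx Dy; rewrite /ripY (ripC hip) (ripC hip x.2).
- by move=> x Dx; rewrite /ripY -!(seminorm_sqr hq)// addr_ge0// sqr_ge0.
Qed.

Lemma energyE x : energy x x = norm (S x.1) ^+ 2 + norm x.2 ^+ 2 - eps * norm x.1 ^+ 2.
Proof. by rewrite !hnormE !(seminorm_sqr hq). Qed.

(** The difference |S x1|^2 - eps |x1|^2 is the extension of <x1|A0 x1> to [DS], nonnegative by
    [pos_sqrt_lower_bound]. *)
Lemma norm2_le_energy x : inY DS x -> norm x.2 ^+ 2 <= energy x x.
Proof.
move=> Dx; rewrite energyE.
have := pos_sqrt_lower_bound hip hcomp sa eps0 coercive hS Dx; lra.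
Qed.

Lemma energy_semi_inner : semi_inner (inY DS : set (V * V)%type) energy.
Proof.
have [_ YD YZ YC _] := ripY_semi_inner.
split; first exact: subspaceY.
- move=> x y z Dx Dy Dz; rewrite /energy YD// (semi_innerDl hq)//; ring.
- move=> r x y Dx Dy; rewrite /energy YZ// (semi_innerZl hq)//; ring.
- by move=> x y Dx Dy; rewrite /energy YC// (ripC hip x.1).
- by move=> x Dx; apply: le_trans (norm2_le_energy Dx); rewrite sqr_ge0.
Qed.

Lemma energy_le_ripY x : energy x x <= ripY x x.
Proof.
rewrite /energy lerBlDr lerDl mulr_ge0 ?(ltW eps0)//.
by rewrite -(seminorm_sqr hq)// sqr_ge0.
Qed.

Lemma Y_complete : seminorm_complete (inY DS : set (V * V)%type) (seminorm_of ripY).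
Proof.
move=> u uP cau; have Du n : DS (u n).1 := uP n.
have le_hyp a b : 0 <= a -> a <= Num.sqrt (a ^+ 2 + b ^+ 2).
  by move=> a0; rewrite -{1}[a]ger0_norm// -sqrtr_sqr ler_wsqrtr// lerDl sqr_ge0.
have comp1 x : norm (S x.1) <= seminorm_of ripY x.
  by rewrite -normYE; apply: le_hyp; exact: (seminorm_ge0 rip).
have comp2 x : norm x.2 <= seminorm_of ripY x.
  by rewrite -normYE /normY addrC; apply: le_hyp; exact: (seminorm_ge0 rip).
have SB x y : DS x -> DS y -> S (x - y) = S x - S y.
  move=> Dx Dy; have Dn := subspaceN sDS Dy.
  by rewrite SD// -(scaleN1r y) SZ// scaleN1r.
have [|g hg] := hcomp (u := fun n => S (u n).1).
  move=> e /cau[K hK]; exists K => m n Km Kn.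
  rewrite -(SB _ _ (Du m) (Du n)); apply: le_lt_trans (hK m n Km Kn).
  exact: (comp1 (u m - u n)).
have [|w hw] := hcomp (u := fun n => (u n).2).
  move=> e /cau[K hK]; exists K => m n Km Kn.
  by apply: le_lt_trans (hK m n Km Kn); exact: (comp2 (u m - u n)).
(* The norm of Y sees the first component only through S, so a preimage of the limit of S u1 serves
   as its limit. *)
have [v DSv Sv] := pos_sqrt_surjective hip hcomp sa eps0 coercive hS g.
exists (v, w) => // e e0.
have [K1 h1] := hg _ (divr_gt0 e0 (ltr0n _ 2)).
have [K2 h2] := hw _ (divr_gt0 e0 (ltr0n _ 2)).
exists (maxn K1 K2) => n; rewrite geq_max => /andP[Kn1 Kn2].
rewrite -normYE /normY /= SB// Sv.
have := h1 n Kn1; have := h2 n Kn2.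
have := seminorm_ge0 rip (S (u n).1 - g); have := seminorm_ge0 rip ((u n).2 - w).
rewrite -!hnormE; move: (norm _) (norm _) => a b b0 a0 b1 a1.
rewrite -[e]ger0_norm ?(ltW e0)// -sqrtr_sqr ltr_sqrt ?exprn_gt0//; nra.
Qed.

(** Approximate S x1 by g in [DS] and take v with S v = g: then v is in [D] because S v is in [DS],
    and its error in Y is |S x1 - g|. *)
Lemma domH_dense x e : inY DS x -> 0 < e ->
  exists2 y, domH D DS y & seminorm_of ripY (x - y) < e.
Proof.
move=> Dx e0; have [_ [_ [DDS _]]] := hS.
have [[_ [dense _]] _] := saS.
have e2 := divr_gt0 e0 (ltr0n R 2).
have [g [DSg hg]] := dense (S x.1) _ e2; have [w [DSw hw]] := dense x.2 _ e2.
have [v DSv Sv] := pos_sqrt_surjective hip hcomp sa eps0 coercive hS g.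
exists (v, w); first by split=> //; apply/DDS; rewrite Sv.
rewrite -normYE /normY /=.
have Dn := subspaceN sDS DSv.
rewrite SD// -(scaleN1r v) SZ// scaleN1r Sv.
move: hg hw.
have := seminorm_ge0 rip (S x.1 - g); have := seminorm_ge0 rip (x.2 - w).
rewrite -!hnormE; move: (norm _) (norm _) => a b b0 a0 b1 a1.
rewrite -[e]ger0_norm ?(ltW e0)// -sqrtr_sqr ltr_sqrt ?exprn_gt0//; nra.
Qed.

Variables (B C : V -> V) (pm : bool).
Hypothesis hC : forall x, DS x -> C x = - (eps%:C *: x).
Local Notation G := (Gop pm A B C).
Local Notation sg := (if pm then 1 else -1 : R).

Lemma domH_Y x : domH D DS x -> inY DS x.
Proof. by move=> [Dx _]; have [_ [_ [DDS _]]] := hS; case/DDS: Dx. Qed.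

(** Since G_- = - G_+, both cases run through one computation with the sign [sg]. *)
Lemma GopE x : domH D DS x -> - (G x : (V * V)%type) =
  (sg%:C *: x.2, sg%:C *: (eps%:C *: x.1 - A x.1 - 'i *: B x.2)).
Proof.
move=> Dx; have DSx := domH_Y Dx.
have ii : 'i * 'i = -1 :> R[i] by rewrite -expr2 sqr_i.
rewrite /Gop /Hop /Bhat /Vop /scaleY /addY /= hC//.
apply: injective_projections => /=.
  by rewrite !addr0; case: pm; rewrite ?scaleNr ?scalerN scalerA ii ?scaleN1r
    ?rmorphN ?rmorph1 ?scaleN1r ?scale1r ?opprK.
set Z := (_ + _ : V).
have iZ : 'i *: Z = eps%:C *: x.1 - A x.1 - 'i *: B x.2.
  rewrite /Z !scalerDr !scalerN !scalerA ii scaleN1r mulN1r scaleNr opprK.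
  by rewrite addrC addrA.
rewrite -iZ; case: pm; rewrite ?scaleNr ?opprK ?rmorphN rmorph1 ?scaleN1r//.
by rewrite scale1r.
Qed.

Lemma Gop_Y x : domH D DS x -> inY DS (G x).
Proof.
move=> Dx; rewrite -[G x]opprK GopE// /inY /=.
by apply: subspaceN => //; apply: subspaceZ => //; case: Dx.
Qed.

(** The left side is half the derivative of the energy, hence mu and not 2 mu; the absolute value in
    the hypothesis serves both signs. *)
Lemma energy_dissipation (mu : R) x :
  (forall y, DS y -> `|complex.Im (ip y (B y))| <= mu * norm y ^+ 2) -> 0 <= mu ->
  domH D DS x -> energy x (- (G x : (V * V)%type)) <= mu * energy x x.
Proof.
move=> hB mu0 Dx; have DSx := domH_Y Dx.
have [Dx1 DSx2] := Dx; have [_ [_ [DDS SS]]] := hS.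
have [_ DSS] := (DDS _).1 Dx1.
rewrite GopE// /energy /ripY /= SZ//.
rewrite !(ripZr hip) !(ripDr hip) (ripZr hip) !(semi_innerNr hq)// (rip_iZr hip).
(* Moving S across produces <x2|A x1>, which cancels the -A x1 of the second component. The eps
   terms cancel against the correction in [energy], so only B contributes. *)
have -> : rip (S x.1) (S x.2) = rip x.2 (A x.1).
  by rewrite (ripC hip x.2); congr complex.Re; rewrite -(self_adjoint_sym saS)// SS.
rewrite (ripC hip x.1).
set r := rip _ _; set r' := rip _ _; set im := complex.Im _.
have -> : sg * r + sg * (eps * r' - r - - im) - eps * (sg * r') = sg * im by ring.
apply: (@le_trans _ _ `|im|).
  by case: (pm); rewrite ?mul1r ?mulN1r ?ler_norm// -normrN ler_norm.
apply: (le_trans (hB _ DSx2)); rewrite ler_wpM2l//.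
exact: norm2_le_energy.
Qed.

(** * Growth of the semigroup on Y *)

Section SemigroupBound.
Variables (T : R -> V * V -> V * V) (mu : R).
Hypothesis hT : C0_semigroup_gen ip DS S (domH D DS) G T.
Hypothesis mu0 : 0 <= mu.
Hypothesis hB : forall y, DS y -> `|complex.Im (ip y (B y))| <= mu * norm y ^+ 2.

Let N := seminorm_of ripY.
(** [addY], [scaleY] and [oppY] are convertible to the module operations of the product, so the
    semigroup axioms can be read in this module. *)
Let W : lmodType R[i] := (V * V)%type.

Let TP t x : 0 <= t -> inY DS x -> inY DS (T t x).
Proof. by case: hT => h _; exact: h. Qed.

Let TL t (c : R[i]) (x y : W) : 0 <= t -> inY DS x -> inY DS y ->
  T t (c *: x + y) = c *: (T t x : W) + T t y.
Proof. by case: hT => _ [h _]; exact: h. Qed.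

Let TB t : 0 <= t -> exists M : R, forall x, inY DS x -> N (T t x) <= M * N x.
Proof.
case: hT => _ [_ [h _]] /h[M hM]; exists M => x Dx.
by rewrite /N -!normYE; exact: hM.
Qed.

Let T0 x : inY DS x -> T 0 x = x.
Proof. by case: hT => _ [_ [_ [h _]]]; exact: h. Qed.

Let TDD t s x : 0 <= t -> 0 <= s -> inY DS x -> T (t + s) x = T t (T s x).
Proof. by case: hT => _ [_ [_ [_ [h _]]]]; exact: h. Qed.

Let Tcont x : inY DS x -> forall e : R, 0 < e -> exists2 d : R, 0 < d &
  forall h, 0 < h < d -> N ((T h x : W) - x) < e.
Proof.
case: hT => _ [_ [_ [_ [_ [h _]]]]] Dx e e0; have [d d0 hd] := h x Dx e e0.
by exists d => // r /hd; rewrite normYE.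
Qed.

Let Tgen (x y : W) : inY DS x -> inY DS y ->
  ((forall e : R, 0 < e -> exists2 d : R, 0 < d & forall h, 0 < h < d ->
      N ((h^-1)%:C *: ((T h x : W) - x) - y) < e) <->
   (domH D DS x /\ y = - (G x : W))).
Proof.
case: hT => _ [_ [_ [_ [_ [_ h]]]]] Dx Dy; have [h1 h2] := h x y Dx Dy.
split=> [lim|/h2 lim e e0].
  apply: h1 => e e0; have [d d0 hd] := lim e e0.
  by exists d => // r /hd; rewrite normYE.
by have [d d0 hd] := lim e e0; exists d => // r /hd; rewrite normYE.
Qed.

Let growth := semigroup_energy_growth ripY_semi_inner Y_complete TP TL TB T0 TDD Tcont
  Tgen domH_Y Gop_Y.
Let fgrowth := semigroup_functional_growth ripY_semi_inner Y_complete TP TL TB T0 TDD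
  Tcont Tgen domH_Y Gop_Y.
Let Tdom := semigroup_domain ripY_semi_inner TP TL TB TDD Tgen domH_Y Gop_Y.

Lemma energy_growth x t : domH D DS x -> 0 <= t ->
  energy (T t x) (T t x) <= expR (mu * t) ^+ 2 * energy x x.
Proof.
move=> Dx t0; rewrite -expRM_natl mulrA.
apply: growth => //; first exact: energy_semi_inner.
- by move=> y _; exact: energy_le_ripY.
- by move=> y; exact: energy_dissipation.
Qed.

(** Pairing the orbit with the fixed vector w = u1(t) turns the bound on |u2| into one on <w|u1(t)>
    = |w|^2, which is then divided by |w|. *)
Lemma first_component_growth x t : domH D DS x -> 0 <= t ->
  norm (T t x).1 <= norm x.1 + expR (mu * t) * Num.sqrt (energy x x) * t.
Proof.
move=> Dx t0; have Yx := domH_Y Dx.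
set w := (T t x).1; set p := Num.sqrt _.
have E0 y : inY DS y -> 0 <= energy y y.
  by case: energy_semi_inner => _ _ _ _; apply.
have Nw0 : 0 <= norm w by exact: (seminorm_ge0 rip).
have sq0 : 0 < Num.sqrt eps by rewrite sqrtr_gt0.
have u2 s : 0 <= s <= t -> norm (T s x).2 <= expR (mu * t) * p.
  move=> /andP[s0 st].
  rewrite -ler_sqr ?nnegrE ?mulr_ge0 ?expR_ge0 ?sqrtr_ge0 ?(seminorm_ge0 rip)//.
  apply: (le_trans (norm2_le_energy (TP s0 Yx))).
  apply: (le_trans (energy_growth Dx s0)).
  rewrite exprMn [p ^+ 2]sqr_sqrtr ?E0// ler_wpM2r ?E0//.
  by rewrite ler_sqr ?nnegrE ?expR_ge0// ler_expR ler_wpM2l.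
have : rip w (T t x).1 <= rip w x.1 + norm w * (expR (mu * t) * p) * t.
  (* [K] comes from |y1| <= eps^(-1/2) |S y1|, where |S y1| is at most the norm of y in Y. *)
  apply: (fgrowth (phi := fun y : V * V => rip w y.1) (K := norm w / Num.sqrt eps)) => //.
  - by move=> y z _ _; rewrite (ripDr hip).
  - by move=> r y _; rewrite (ripZr hip).
  - move=> y Dy; apply: (le_trans (semi_inner_CS hq (I : setT w) (I : setT y.1))).
    rewrite -mulrA ler_wpM2l// ler_pdivlMl//.
    rewrite -ler_sqr ?nnegrE ?mulr_ge0 ?(ltW sq0) ?seminorm_ge0//.
    rewrite exprMn sqr_sqrtr ?(ltW eps0)// -hnormE.
    apply: (le_trans (pos_sqrt_lower_bound hip hcomp sa eps0 coercive hS Dy)).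
    by rewrite (seminorm_sqr ripY_semi_inner)// /ripY -!(seminorm_sqr hq)// lerDl sqr_ge0.
  - by rewrite divr_ge0// ltW.
  - move=> s /andP[s0 st]; rewrite GopE; last exact: Tdom.
    rewrite /= (ripZr hip).
    have b := u2 s; rewrite s0 st in b; have {}b := b isT.
    have cs := semi_inner_CS hq (I : setT w) (I : setT (T s x).2).
    have cs' := semi_inner_CS hq (I : setT w) (I : setT (- (T s x).2)).
    rewrite (semi_innerNr hq)// (seminormN hq)// in cs'.
    apply: (le_trans (y := norm w * norm (T s x).2)); last by rewrite ler_wpM2l.
    by case: (pm); rewrite ?mul1r ?mulN1r.
have cs := semi_inner_CS hq (I : setT w) (I : setT x.1).
rewrite -/w -(seminorm_sqr hq)// -!hnormE => h.
have [w0|wn0] := eqVneq (norm w) 0.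
  rewrite w0 addr_ge0 ?(seminorm_ge0 rip)//.
  by rewrite !mulr_ge0 ?expR_ge0 ?sqrtr_ge0.
have wp : 0 < norm w by rewrite lt0r wn0.
rewrite -(ler_pM2l wp) -expr2; apply: (le_trans h).
by rewrite mulrDr -[_ * _ * t]mulrA; apply: lerD.
Qed.

Lemma semigroup_norm_domH x t : domH D DS x -> (Num.sqrt eps)^-1 <= t ->
  N (T t x) <= expR 1 * Num.sqrt eps * t * expR (mu * t) * N x.
Proof.
move=> Dx ht; have Yx := domH_Y Dx.
have sq0 : 0 < Num.sqrt eps by rewrite sqrtr_gt0.
have t0 : 0 <= t by apply: le_trans ht; rewrite invr_ge0 ltW.
have tau1 : 1 <= Num.sqrt eps * t by rewrite -ler_pdivrMl// mulr1.
have sqe : Num.sqrt eps ^+ 2 = eps by rewrite sqr_sqrtr// ltW.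
have E0 y : inY DS y -> 0 <= energy y y.
  by case: energy_semi_inner => _ _ _ _; apply.
have NE y : inY DS y -> N y ^+ 2 = energy y y + (Num.sqrt eps * norm y.1) ^+ 2.
  move=> Dy; rewrite (seminorm_sqr ripY_semi_inner)// exprMn sqe.
  by rewrite hnormE (seminorm_sqr hq)// /energy subrK.
have Nx0 : 0 <= N x by exact: seminorm_ge0.
have e2 : 2 <= expR 1 :> R by have := expR_ge1Dx (1 : R); lra.
have M1 : 1 <= expR (mu * t) by rewrite -expR0 ler_expR mulr_ge0.
rewrite -ler_sqr ?nnegrE ?mulr_ge0 ?expR_ge0 ?(ltW sq0) ?seminorm_ge0//.
rewrite NE; last exact: TP.
have := first_component_growth Dx t0; have := energy_growth Dx t0.
have := NE _ Yx.
have ps := sqr_sqrtr (E0 _ Yx); move: ps.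
have := sqrtr_ge0 (energy x x).
set p := Num.sqrt (energy x x) => p0 <- Nx g1 g2.
have q0 : 0 <= Num.sqrt eps * norm x.1.
  by rewrite mulr_ge0 ?(ltW sq0) ?(seminorm_ge0 rip).
have v0 : 0 <= Num.sqrt eps * norm (T t x).1.
  by rewrite mulr_ge0 ?(ltW sq0) ?(seminorm_ge0 rip).
have g3 : Num.sqrt eps * norm (T t x).1 <=
    Num.sqrt eps * norm x.1 + expR (mu * t) * p * (Num.sqrt eps * t).
  have := ler_wpM2l (ltW sq0) g2; rewrite mulrDr => h; apply: (le_trans h).
  by rewrite le_eqVlt; apply/orP; left; apply/eqP; ring.
move: (energy (T t x) (T t x)) (Num.sqrt eps * norm (T t x).1) g1 v0 g3.
(* Now p^2 is the initial energy, q = eps^(1/2) |x1| and p^2 + q^2 = |x|^2; E and v are the energy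
   and eps^(1/2) |u1| at time t. *)
move: (Num.sqrt eps * norm x.1) q0 Nx => q q0 Nx E v g1 v0 g3.
have -> : expR 1 * Num.sqrt eps * t * expR (mu * t) * N x =
  expR 1 * (Num.sqrt eps * t) * expR (mu * t) * N x by ring.
move: (Num.sqrt eps * t) tau1 g3 => tau tau1 g3.
move: (expR (mu * t)) (expR 1) M1 e2 g1 g3 => M c M1 c2 g1 g3.
have g4 : v <= M * (q + tau * p).
  apply: (le_trans g3); rewrite mulrDr; apply: lerD; first by rewrite ler_peMl.
  by rewrite le_eqVlt; apply/orP; left; apply/eqP; ring.
have g5 : v ^+ 2 <= M ^+ 2 * (q + tau * p) ^+ 2.
  rewrite -exprMn ler_sqr ?nnegrE// mulr_ge0//; first lra.
  by rewrite addr_ge0// mulr_ge0//; lra.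
apply: (@le_trans _ _ (M ^+ 2 * (p ^+ 2 + (q + tau * p) ^+ 2))); first lra.
have -> : (c * tau * M * N x) ^+ 2 = M ^+ 2 * (c ^+ 2 * tau ^+ 2 * N x ^+ 2) by ring.
rewrite ler_wpM2l ?sqr_ge0// Nx.
have c4 : 4 <= c ^+ 2 by nra.
(* (q + tau p)^2 <= 2 q^2 + 2 tau^2 p^2 and tau >= 1 give at most 3 tau^2 p^2 + 2 tau^2 q^2, which
   the factor 4 absorbs. *)
apply: (@le_trans _ _ (4 * (tau ^+ 2 * (p ^+ 2 + q ^+ 2)))); last first.
  by rewrite -mulrA ler_wpM2r// mulr_ge0 ?sqr_ge0// addr_ge0 ?sqr_ge0.
have t2 : 1 <= tau ^+ 2 by rewrite expr_ge1// (le_trans ler01).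
have cross : 2 * q * (tau * p) <= q ^+ 2 + (tau * p) ^+ 2 by have := sqr_ge0 (q - tau * p); lra.
have h1 : p ^+ 2 <= tau ^+ 2 * p ^+ 2 by rewrite ler_peMl ?sqr_ge0.
have h2 : q ^+ 2 <= tau ^+ 2 * q ^+ 2 by rewrite ler_peMl ?sqr_ge0.
have -> : (q + tau * p) ^+ 2 = q ^+ 2 + 2 * q * (tau * p) + (tau * p) ^+ 2 by ring.
move: cross; rewrite exprMn; have := sqr_ge0 p; have := sqr_ge0 q; lra.
Qed.

(** T(t) is bounded with some uncontrolled constant [M]; density of D(H) confines [M] to an error
    term that tends to 0. *)
Lemma opnormY_bound t : (Num.sqrt eps)^-1 <= t ->
  opnormY ip DS S T t <= expR 1 * Num.sqrt eps * t * expR (mu * t).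
Proof.
move=> ht; set K := _ * expR (mu * t).
have sq0 : 0 < Num.sqrt eps by rewrite sqrtr_gt0.
have t0 : 0 <= t by apply: le_trans ht; rewrite invr_ge0 ltW.
have K0 : 0 <= K by rewrite !mulr_ge0 ?expR_ge0 ?(ltW sq0).
apply: ge_sup.
  exists (normY ip S (T t 0)), 0; split; first exact: (subspace0 sDS).
  by split=> //; rewrite normYE (seminorm0 ripY_semi_inner).
move=> r [x [Yx [x1 ->]]]; rewrite normYE in x1; rewrite normYE -/N.
have [M hM] := TB t0.
apply/ler_addgt0Pr => e e0.
(* For d = |x - y| one gets |T(t) x| <= |M| d + K (1 + d), so d < e / (|M| + K + 1) suffices. *)
have c0 : 0 < `|M| + K + 1 by rewrite ltr_wpDl// addr_ge0.
have [y Dy hy] := domH_dense Yx (divr_gt0 e0 c0).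
have Yy := domH_Y Dy.
have Yd : inY DS ((x : W) - y) by exact: (subspaceB subspaceY Yx Yy).
have split_x : (T t x : W) = T t ((x : W) - y) + T t y.
  rewrite -{1}[x](subrK (y : W)) -[(x : W) - y in LHS]scale1r.
  by rewrite TL// scale1r.
rewrite split_x.
have h1 := ler_seminormD ripY_semi_inner (TP t0 Yd) (TP t0 Yy).
have h2 := semigroup_norm_domH Dy ht; rewrite -/K in h2.
have h3 := ler_seminorm_dist ripY_semi_inner Yy Yx.
rewrite (seminormBC ripY_semi_inner Yy Yx) in h3.
have h4 := hM _ Yd.
move: hy; rewrite ltr_pdivlMr// => hy.
have d0 := seminorm_ge0 ripY ((x : W) - y).
apply: (le_trans h1); apply: (le_trans (lerD h4 h2)).
have h5 : K * N y <= K * (1 + N ((x : W) - y)).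
  by rewrite ler_wpM2l//; apply: (le_trans h3); rewrite lerD2r.
have h6 : M * N ((x : W) - y) <= `|M| * N ((x : W) - y) by rewrite ler_wpM2r// ler_norm.
rewrite -/N in hy d0 *.
move: h5 h6 hy d0; move: (N ((x : W) - y)) (N y) `|M| => a b m; lra.
Qed.

End SemigroupBound.
End EnergySpace.

(** * The two kinds of perturbation B *)

Lemma symmetric_Im_eq0 (R : realType) (V : lmodType R[i]) (ip : V -> V -> R[i])
    (D : set V) (B : V -> V) x :
  is_inner_product ip -> symmetric_on ip D B -> D x -> complex.Im (ip x (B x)) = 0.
Proof.
move=> hip sB Dx; have := sB x x Dx Dx; rewrite (ip_conj hip x).
by case: (ip x (B x)) => u v [] /=; lra.
Qed.

(** Im <x|B x> is minus the real pairing of x with i B x, so Cauchy-Schwarz applies;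
    [le_sup_unit_ball] turns the supremum defining the operator norm into an actual bound. *)
Lemma bounded_Im_le (R : realType) (V : lmodType R[i]) (ip : V -> V -> R[i])
    (D : set V) (B : V -> V) :
  is_inner_product ip -> Defs.subspace D -> linear_on D B -> bounded_on ip D B ->
  0 <= opnorm_on ip D B /\ forall x, D x ->
    `|complex.Im (ip x (B x))| <= opnorm_on ip D B * hnorm ip x ^+ 2.
Proof.
move=> hip sD lB [M hM]; have hq := rip_semi_inner hip.
have D0 := subspace0 sD.
have B0 : B 0 = 0.
  by have := lB (-1) _ _ D0 D0; rewrite scaler0 addr0 scaleN1r addNr.
have FZ (r : R) x : D x -> hnorm ip (B (r%:C *: x)) = `|r| * hnorm ip (B x).
  move=> Dx; rewrite -[r%:C *: x]addr0 lB// B0 addr0.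
  exact: (seminormZ hq).
have [hE leE] := le_sup_unit_ball sD (seminorm0 hq) (fun x _ => seminorm_ge0 _ x)
  (fun r x _ => seminormZ hq r (I : setT x)) FZ hM.
split.
  apply: (sup_upper_bound hE); exists 0; split=> //.
  by rewrite B0 [seminorm_of _ 0](seminorm0 hq) [hnorm ip 0](seminorm0 hq).
move=> x Dx; have Nx := seminorm_ge0 (rip ip) x.
apply: (@le_trans _ _ (hnorm ip x * hnorm ip (B x))).
  have cs := semi_inner_CS hq (I : setT x) (I : setT ('i *: B x)).
  have cs' := semi_inner_CS hq (I : setT x) (I : setT (- ('i *: B x))).
  rewrite (semi_innerNr hq)// (seminormN hq)// in cs'.
  move: cs cs'; rewrite (rip_iZr hip) opprK -!hnormE (hnorm_iZ hip) => c1 c2.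
  by rewrite ler_norml c2 andbT lerNl.
by rewrite mulrC expr2 mulrA ler_wpM2r//; exact: leE.
Qed.

Unset Implicit Arguments.

Theorem theorem16 (R : realType) (V : lmodType R[i]) (ip : V -> V -> R[i])
  (eps : R) (D : set V) (A A0 : V -> V) (DS : set V) (S : V -> V)
  (a b : R) (B C : V -> V) (pm : bool) (T : R -> V * V -> V * V) :
  is_hilbert ip ->
  0 < eps ->
  self_adjoint ip D A ->
  (forall x, D x -> eps%:C * ip x x <= ip x (A x)) ->
  is_pos_sqrt ip D A DS S ->
  linear_on DS B ->
  0 <= a -> a < 1 ->
  (forall x, DS x -> hnorm ip (B x) ^+ 2 <= a ^+ 2 * hnorm ip (S x) ^+ 2 + b ^+ 2 * hnorm ip x ^+ 2) ->
  (symmetric_on ip DS B \/ bounded_on ip DS B) ->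
  self_adjoint ip D A0 -> positive_op ip D A0 ->
  (forall x, D x -> A x = A0 x + eps%:C *: x) ->
  (forall x, DS x -> C x = - (eps%:C *: x)) ->
  C0_semigroup_gen ip DS S (domH D DS) (Gop pm A B C) T ->
  forall t : R, (Num.sqrt eps)^-1 <= t ->
    (symmetric_on ip DS B ->
       opnormY ip DS S T t <= expR 1 * Num.sqrt eps * t * expR (0 * t)) /\
    (bounded_on ip DS B ->
       opnormY ip DS S T t <= expR 1 * Num.sqrt eps * t * expR (opnorm_on ip DS B * t)).
Proof.
move=> [hip [hcomp _]] eps0 sa coer hS lB _ _ _ _ _ _ _ hC hT t ht.
have sDS : Defs.subspace DS by case: hS => [[[]]].
split=> [sB|bB].
  apply: (opnormY_bound hip hcomp eps0 sa coer hS hC hT) => // y DSy.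
  by rewrite (symmetric_Im_eq0 hip sB DSy) normr0 mul0r.
have [mu0 hmu] := bounded_Im_le hip sDS lB bB.
exact: (opnormY_bound hip hcomp eps0 sa coer hS hC hT mu0 hmu).
Qed.
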